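(* Let $N\ge 1$, $p_c:=\frac{2N}{N+1}$, $p\in(p_c,2)$ and $q\in[p-1,p/2)$. Set $q_1:=\max\left\{p-1,\frac{N}{N+1}\right\}$. Let $u_0\in W^{1,\infty}(\mathbb{R}^N)$ satisfy $u_0\ge 0$, $u_0\not\equiv 0$, and assume that there exist $C_0>0$ and $Q>0$ such that $$u_0(x)\le C_0|x|^{-(p-Q)/(Q-p+1)},\qquad x\in\mathbb{R}^N,$$ where $Q=q$ if $q\in(q_1,p/2)$ and $Q\in(q_1,p/2)$ if $q\in(0,q_1]$. Let $u$ be the solution to $\partial_t u-\Delta_p u+|\nabla u|^q=0$ in $(0,\infty)\times\mathbb{R}^N$ with $u(0)=u_0$, and let $\mathcal{P}(t):=\{x\in\mathbb{R}^N:\ u(t,x)>0\}$. Then $u$ vanishes identically after a finite time $T_e$ and $$\mathcal{P}(t)=\mathbb{R}^N\qquad\text{for } t\in(0,T_e).$$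
   Context: $\Delta_p u=\mathrm{div}(|\nabla u|^{p-2}\nabla u)$. For $p\in(p_c,2]$, $q>0$ and $u_0\in W^{1,\infty}(\mathbb{R}^N)$ with $u_0\ge0$, $u_0\not\equiv0$, it is known that the Cauchy problem $\partial_t u-\Delta_p u+|\nabla u|^q=0$ in $(0,\infty)\times\mathbb{R}^N$, $u(0)=u_0$, has a unique nonnegative viscosity solution $u\in\mathcal{BC}([0,\infty)\times\mathbb{R}^N)\cap L^\infty(0,\infty;W^{1,\infty}(\mathbb{R}^N))$ ($\mathcal{BC}$: bounded continuous functions), which is also a weak solution if $p<2$ and a classical solution if $p=2$, and satisfies $0\le u\le\|u_0\|_\infty$. ''The solution'' means this one. The extinction time $T_e$ is the time such that $u(t)\equiv0$ for $t\ge T_e$ and $u(t)\not\equiv 0$ for $t\in[0,T_e)$. *)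

(* Defs.v *)
From HB Require Import structures.
From mathcomp Require Import all_boot all_order all_algebra.
From mathcomp Require Import all_classical all_reals all_analysis.

Set Implicit Arguments.
Unset Strict Implicit.
Unset Printing Implicit Defensive.
Import Order.TTheory GRing.Theory Num.Theory.
Import numFieldNormedType.Exports.
Local Open Scope classical_set_scope.
Local Open Scope ring_scope.

(* R^N is 'rV[R]_N with the sigma-algebra generated by the coordinates; its
   Lebesgue measure is the N-fold product of the one-dimensional one. *)
Definition measure_rV_display : measure_display -> measure_display.
Proof. exact. Qed.

Section measurable_rV.
Context {d} {T : sigmaRingType d} (n : nat).

Let coord : 'I_n -> 'rV[T]_n -> T := fun i x => x ord0 i.

Let rV_set0 : g_sigma_preimage coord set0.
Proof. exact: sigma_algebra0. Qed.

Let rV_setC A : g_sigma_preimage coord A -> g_sigma_preimage coord (~` A).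
Proof. exact: sigma_algebraC. Qed.

Let rV_bigcup (F : _^nat) : (forall i, g_sigma_preimage coord (F i)) ->
  g_sigma_preimage coord (\bigcup_i (F i)).
Proof. exact: sigma_algebra_bigcup. Qed.

HB.instance Definition _ := @isMeasurable.Build (measure_rV_display d)
  'rV[T]_n (g_sigma_preimage coord) rV_set0 rV_setC rV_bigcup.

End measurable_rV.

Lemma measurable_coord d (T : sigmaRingType d) n (i : 'I_n) :
  measurable_fun [set: 'rV[T]_n] (fun x => x ord0 i).
Proof.
move=> _ Y mY; rewrite setTI; apply: sub_sigma_algebra => /=.
rewrite -bigcup_seq/=; exists i => /=; first by rewrite mem_index_enum.
by exists Y => //; rewrite setTI.
Qed.

Lemma measurable_fun_rVP d1 d2 (T1 : measurableType d1) (T2 : measurableType d2)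
    n (f : T1 -> 'rV[T2]_n) :
  (forall i, measurable_fun setT (fun x => f x ord0 i)) ->
  measurable_fun setT f.
Proof.
move=> mf _ A mA; rewrite setTI.
pose g i x := f x ord0 i.
have : preimage_set_system setT f (g_sigma_preimage (fun i (x : 'rV[T2]_n) => x ord0 i))
       (f @^-1` A) by exists A => //; rewrite setTI.
rewrite -g_sigma_preimage_comp; apply: smallest_sub.
  exact: sigma_algebra_measurable.
rewrite -bigcup_seq; apply: bigcup_sub => i _ B [C mC <-].
exact: mf.
Qed.

Definition rV_cons (T : Type) n (z : T * 'rV[T]_n) : 'rV[T]_n.+1 :=
  \row_(i < n.+1) if unlift ord0 i is Some j then z.2 ord0 j else z.1.

Definition rV_uncons (T : Type) n (x : 'rV[T]_n.+1) : T * 'rV[T]_n :=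
  (x ord0 ord0, \row_(j < n) x ord0 (lift ord0 j)).

Lemma rV_consK T n : cancel (@rV_cons T n) (@rV_uncons T n).
Proof.
case=> t x; rewrite /rV_uncons/= mxE unlift_none/=; congr pair.
by apply/rowP => j; rewrite !mxE liftK.
Qed.

Section lebesgue_rV.
Context {R : realType}.

Lemma measurable_rV_cons n : measurable_fun setT
  (@rV_cons R n : measurableTypeR R * 'rV[R]_n -> 'rV[R]_n.+1).
Proof.
apply: measurable_fun_rVP => i.
have [j ->|->] := unliftP ord0 i.
  rewrite (_ : (fun _ => _) = (fun x : 'rV[R]_n => x ord0 j) \o snd).
    by apply: measurableT_comp => //; exact: measurable_coord.
  by apply/funext => z; rewrite mxE liftK.
rewrite (_ : (fun _ => _) = fst)//.
by apply/funext => z; rewrite mxE unlift_none.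
Qed.

Lemma measurable_rV_uncons n : measurable_fun setT
  (@rV_uncons R n : 'rV[R]_n.+1 -> measurableTypeR R * 'rV[R]_n).
Proof.
apply/measurable_fun_pairP; split; first exact: measurable_coord.
apply: measurable_fun_rVP => j.
rewrite (_ : (fun _ => _) = (fun x : 'rV[R]_n.+1 => x ord0 (lift ord0 j))).
  exact: measurable_coord.
by apply/funext => x; rewrite mxE.
Qed.

Section step.
Variables (n : nat) (m : {sigma_finite_measure set 'rV[R]_n -> \bar R}).

Definition lebesgue_rV_step : set 'rV[R]_n.+1 -> \bar R :=
  pushforward (lebesgue_measure \x m)%E (@rV_cons R n).

Let step0 : lebesgue_rV_step set0 = 0%E.
Proof. by rewrite /lebesgue_rV_step /pushforward preimage_set0 measure0. Qed.

Let step_ge0 A : (0 <= lebesgue_rV_step A)%E.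
Proof. by rewrite /lebesgue_rV_step /pushforward; exact: measure_ge0. Qed.

Let step_sigma_additive : semi_sigma_additive lebesgue_rV_step.
Proof.
move=> F mF tF mUF; rewrite /lebesgue_rV_step /pushforward preimage_bigcup.
have mcons A : measurable A -> measurable (@rV_cons R n @^-1` A).
  by move=> mA; rewrite -[X in measurable X]setTI; exact: measurable_rV_cons.
apply: measure_semi_sigma_additive => [k||]; first exact: mcons.
- apply/trivIsetP => /= i j _ _ ij; rewrite -preimage_setI.
  by move/trivIsetP : tF => /(_ _ _ _ _ ij) ->//; rewrite preimage_set0.
- by rewrite -preimage_bigcup; exact: mcons.
Qed.

HB.instance Definition _ := isMeasure.Build _ _ _
  lebesgue_rV_step step0 step_ge0 step_sigma_additive.

Lemma lebesgue_rV_step_sigma_finite : sigma_finite setT lebesgue_rV_step.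
Proof.
have /sigma_finiteP[F [TF ndF Foo]] := sigma_finiteT (@lebesgue_measure R).
have /sigma_finiteP[G [TG ndG Goo]] := sigma_finiteT m.
exists (fun k => @rV_uncons R n @^-1` (F k `*` G k)).
  apply/esym/seteqP; split=> // x _.
  have [i _ Fi] : (\bigcup_i F i) (x ord0 ord0) by rewrite -TF.
  have [j _ Gj] : (\bigcup_i G i) (rV_uncons x).2 by rewrite -TG.
  exists (maxn i j) => //; split => /=.
    by move: Fi; exact/subsetPset/ndF/leq_maxl.
  by move: Gj; exact/subsetPset/ndG/leq_maxr.
move=> k; have [mF Fk] := Foo k; have [mG Gk] := Goo k; split.
  rewrite -[X in measurable X]setTI; apply: measurable_rV_uncons => //.
  exact: measurableX.
rewrite /lebesgue_rV_step /pushforward -comp_preimage.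
rewrite (_ : _ \o _ = id); last by apply/funext => z; exact: rV_consK.
by rewrite preimage_id product_measure1E// lte_mul_pinfty// ge0_fin_numE.
Qed.

HB.instance Definition _ := @Measure_isSigmaFinite.Build _ _ _
  lebesgue_rV_step lebesgue_rV_step_sigma_finite.
End step.

Fixpoint lebesgue_rV n : {sigma_finite_measure set 'rV[R]_n -> \bar R} :=
  match n with
  | 0%N => @dirac _ 'rV[R]_0 0 R
  | k.+1 => lebesgue_rV_step (lebesgue_rV k)
  end.

Lemma lebesgue_rV_setX n (A : set (measurableTypeR R)) (B : set 'rV[R]_n) :
  measurable A -> measurable B ->
  lebesgue_rV n.+1 (@rV_uncons R n @^-1` (A `*` B)) =
    (lebesgue_measure A * lebesgue_rV n B)%E.
Proof.
move=> mA mB; rewrite /= /lebesgue_rV_step /pushforward -comp_preimage.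
rewrite (_ : _ \o _ = id); last by apply/funext => z; exact: rV_consK.
by rewrite preimage_id product_measure1E.
Qed.

End lebesgue_rV.

Section calculus.
Context {R : realType}.

(* C^k on an open set U, by means of directional derivatives. *)
Fixpoint Ck_on (V : normedModType R) (U : set V) (k : nat) (f : V -> R) : Prop :=
  (forall x, U x -> {for x, continuous f}) /\
  if k is j.+1 then
    forall v, (forall x, U x -> derivable f x v) /\ Ck_on U j ('D_v f)
  else True.

Definition test_function (V : normedModType R) (U : set V) (phi : V -> R) :=
  (forall k, Ck_on setT k phi) /\
  exists K : set V, [/\ compact K, K `<=` U & forall x, ~ K x -> phi x = 0].

Context {N : nat}.
Implicit Types (x y : 'rV[R]_N) (f : 'rV[R]_N -> R) (F G : 'rV[R]_N -> 'rV[R]_N).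

Definition dotrV x y : R := \sum_(i < N) x ord0 i * y ord0 i.

(* The library norm on row vectors is the sup norm. *)
Definition enorm x : R := Num.sqrt (dotrV x x).

Definition grad f x : 'rV[R]_N := \row_i 'D_(delta_mx ord0 i) f x.

Definition divergence F x : R :=
  \sum_(i < N) 'D_(delta_mx ord0 i) (fun y => F y ord0 i) x.

(* As 0 `^ (p - 2) *: 0 = 0, the flux vanishes where the gradient does. *)
Definition p_flux (p : R) (v : 'rV[R]_N) : 'rV[R]_N := enorm v `^ (p - 2) *: v.

Definition p_laplacian (p : R) f x : R :=
  divergence (fun y => p_flux p (grad f y)) x.

End calculus.

Section sobolev.
Context {R : realType} {N : nat}.
Implicit Types (f : 'rV[R]_N -> R) (G : 'rV[R]_N -> 'rV[R]_N).

Definition Loo_norm f : \bar R :=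
  Lnorm (@lebesgue_rV R N) +oo%E (fun x => (f x)%:E).

Definition weak_gradient f G :=
  forall phi : 'rV[R]_N -> R, test_function setT phi -> forall i,
    \int[@lebesgue_rV R N]_x (f x * 'D_(delta_mx ord0 i) phi x) =
    - \int[@lebesgue_rV R N]_x (G x ord0 i * phi x).

(* M bounds both the L^oo norm of f and that of its weak gradient. *)
Definition W1oo_bounded (M : R) f :=
  [/\ measurable_fun setT f, (Loo_norm f <= M%:E)%E &
      exists G, [/\ measurable_fun setT G, weak_gradient f G &
                    (Loo_norm (fun x => enorm (G x)) <= M%:E)%E]].

Definition W1oo f := exists M, W1oo_bounded M f.

End sobolev.

Section hamilton_jacobi.
Context {R : realType} {N : nat} (p q : R).
Implicit Types u psi phi : R * 'rV[R]_N -> R.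

Definition Qoo : set (R * 'rV[R]_N) := [set z | 0 < z.1].

Definition slice u (t : R) : 'rV[R]_N -> R := fun x => u (t, x).

Definition dt u (t : R) (x : 'rV[R]_N) : R := 'D_1 (fun s => u (s, x)) t.

(* Functions of (t, x) are only meant for 0 <= t; their values for t < 0 are
   irrelevant. *)

(* Viscosity solutions for equations that are singular where the gradient
   vanishes, after Ohnuma and Sato.  A C^2 function on [0, +oo[ whose first two
   derivatives vanish at 0 extends by its value at 0 to a C^2 function on R;
   hence the profiles are taken on R. *)
Definition profile (f : R -> R) :=
  Ck_on setT 2 f /\
  [/\ f 0 = 0, derive1 f 0 = 0, derive1n 2 f 0 = 0, forall r, 0 < r -> 0 < derive1n 2 f r &
      `|derive1 f r| `^ (p - 2) * derive1n 2 f r @[r --> 0^'+] --> 0].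

Definition time_modulus (w : R -> R) :=
  [/\ {within [set r | 0 <= r], continuous w}, forall r, 0 <= r -> 0 <= w r &
      w r / r @[r --> 0^'+] --> 0].

Definition admissible psi :=
  Ck_on Qoo 2 psi /\
  forall t0 x0, 0 < t0 -> grad (slice psi t0) x0 = 0 ->
    exists (delta : R) (f w : R -> R),
      [/\ 0 < delta, profile f, time_modulus w &
          forall t x, 0 < t -> enorm (x - x0) + `|t - t0| < delta ->
            `|psi (t, x) - psi (t0, x0) - dt psi t0 x0 * (t - t0)|
              <= f (enorm (x - x0)) + w `|t - t0|].

Definition viscosity_subsolution u :=
  forall psi (t : R) (x : 'rV[R]_N), admissible psi -> 0 < t ->
    (\forall z \near (t, x), u z - psi z <= u (t, x) - psi (t, x)) ->
    let g := grad (slice psi t) x in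
    (g != 0 -> dt psi t x <= p_laplacian p (slice psi t) x - enorm g `^ q) /\
    (g = 0 -> dt psi t x <= 0).

Definition viscosity_supersolution u :=
  forall psi (t : R) (x : 'rV[R]_N), admissible psi -> 0 < t ->
    (\forall z \near (t, x), u (t, x) - psi (t, x) <= u z - psi z) ->
    let g := grad (slice psi t) x in
    (g != 0 -> p_laplacian p (slice psi t) x - enorm g `^ q <= dt psi t x) /\
    (g = 0 -> 0 <= dt psi t x).

Definition spacetime_measure :=
  (@lebesgue_measure R \x @lebesgue_rV R N)%E.

Definition weak_solution u :=
  exists G : R * 'rV[R]_N -> 'rV[R]_N,
    [/\ measurable_fun Qoo G,
        (exists M : R,
          {ae spacetime_measure, forall z, Qoo z -> enorm (G z) <= M}),
        {ae @lebesgue_measure R, forall t : R, 0 < t ->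
          weak_gradient (slice u t) (fun x => G (t, x))} &
        forall phi, test_function Qoo phi ->
          \int[spacetime_measure]_(z in Qoo)
            (u z * dt phi z.1 z.2
             - dotrV (p_flux p (G z)) (grad (slice phi z.1) z.2)
             - enorm (G z) `^ q * phi z) = 0].

(* The solution of the Cauchy problem in the singular range p < 2, with all the
   properties that single it out or are part of its well-posedness.
   Semicontinuity is not repeated in the viscosity inequalities, as the solution
   is continuous. *)
Record solution (u0 : 'rV[R]_N -> R) u : Prop := Solution {
  solution_continuous :
    {within [set z : R * 'rV[R]_N | 0 <= z.1], continuous u} ;
  solution_bounded : exists M, forall t x, 0 <= t -> `|u (t, x)| <= M ;
  solution_W1oo : exists M : R, {ae @lebesgue_measure R, forall t : R, 0 < t ->
    W1oo_bounded M (slice u t)} ;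
  solution_initial : forall x, u (0, x) = u0 x ;
  solution_subsolution : viscosity_subsolution u ;
  solution_supersolution : viscosity_supersolution u ;
  solution_weak : weak_solution u ;
  solution_ge0 : forall t x, 0 <= t -> 0 <= u (t, x) ;
  solution_le : forall t x, 0 <= t -> ((u (t, x))%:E <= Loo_norm u0)%E }.

Definition extinction_time u (Te : R) :=
  [/\ 0 <= Te, forall t x, Te <= t -> u (t, x) = 0 &
      forall t, 0 <= t < Te -> exists x, u (t, x) != 0].

Definition positivity_set u (t : R) : set 'rV[R]_N := [set x | 0 < u (t, x)].

End hamilton_jacobi.

Definition p_crit {R : realType} (N : nat) : R := 2 * N%:R / (N%:R + 1).

Definition q_one {R : realType} (N : nat) (p : R) : R :=
  Num.max (p - 1) (N%:R / (N%:R + 1)).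

(* Main.v *)
Require Import Defs.
From mathcomp Require Import all_boot all_order all_algebra.
From mathcomp Require Import all_classical all_reals all_analysis.
From mathcomp Require Import ring lra.
Import Order.TTheory GRing.Theory Num.Theory.
Import numFieldNormedType.Exports.
Local Open Scope classical_set_scope.
Local Open Scope ring_scope.
Set Implicit Arguments.
Unset Strict Implicit.
Unset Printing Implicit Defensive.

(** Throughout, the equation reads dt u = Delta_p u - |grad u|^q with 1 < p < 2
and p - 1 <= q < p / 2.  Everything follows from comparing the solution, on
compact cylinders and by means of the viscosity inequalities alone, with
barriers Phi(|x - c|^(2m)) + l t.  For such a barrier the p-Laplacian is
explicit ([p_laplacian_radial_sg]); its only critical point is c, and it is so
flat there, provided m is large, that the barrier is admissible as a test
function ([admissible_barrier]).

Decay.  Put gamma = (p - Q) / (Q - p + 1).  This is the exponent for which the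
diffusion term and the term |grad|^Q have the same size along K |x|^-gamma, and
the second one wins for K large because Q > p - 1.  Hence K |x|^-gamma is a
stationary supersolution where its gradient is at most 1, also when q < Q, and
the bound on the initial datum persists for all times
([stationary_upper_bound]).  The comparison takes place between two spheres:
on the inner one the barrier exceeds sup u, and on the outer one u is small
because its values at far away points are controlled by the nearby initial
values ([localized_upper_bound], [vanishes_at_infinity]).

Extinction.  Outside the ball of radius rho the solution is now at most
b = K rho^-gamma at all times.  Inside, diffusion alone brings u from H down to
2 b in a time of order H b^(1-p) rho^p ([diffusive_drop]).  For the radii
rho = 2^n r0 one has H of order b, so the n-th of these times is of order
rho^(p - gamma (2 - p)).  As Q < p / 2 means gamma (2 - p) > p, they form a
convergent geometric series, at the sum of which u is at most
lim b = 0 ([finite_time_extinction]).  Once the solution is zero it remains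
so, again by [localized_upper_bound] ([zero_persists]).

Positivity.  A bump k exp(-A |x - y|^(2m)) of small height k can spread at any
speed below u: its diffusion term is of order k^(p-1), which dominates the time
derivative, of order k, and, for A large, also the absorption, of order k^q with
q >= p - 1.  Therefore u is positive everywhere at each time at which it is
positive somewhere ([instantaneous_spreading]). *)

(** * Directional derivatives and classes of smooth functions *)

Section directional_calculus.
Context {R : realType} {V : normedModType R}.
Implicit Types (f g s : V -> R) (x v : V).

Lemma is_derive_line f x v a :
  is_derive x v f a <-> is_derive (0 : R) 1 (fun h : R => f (h *: v + x)) a.
Proof.
have E : 'D_v f x = 'D_1 (fun h : R => f (h *: v + x)) 0.
  rewrite /derive; set g1 := fun h => h^-1 *: _; set g2 := fun h => h^-1 *: _.
  suff -> : g1 = g2 by [].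
  by rewrite funeqE /g1 /g2 => h /=; rewrite addr0 scale0r add0r [_%:A]mulr1.
split=> -[df <-]; (split; last by rewrite E).
  exact: (derivable1P f x v).1.
exact: (derivable1P f x v).2.
Qed.

Lemma is_derive_comp_line (F : R -> R) s x v a b :
  is_derive (s x) 1 F a -> is_derive x v s b ->
  is_derive x v (fun y => F (s y)) (a * b).
Proof.
move=> dF /is_derive_line ds; apply/is_derive_line.
apply: (@is_derive1_comp _ F (fun h : R => s (h *: v + x))).
by rewrite scale0r add0r.
Qed.

Lemma is_derive_addf f g x v a b : is_derive x v f a -> is_derive x v g b ->
  is_derive x v (fun y => f y + g y) (a + b).
Proof. by move=> df dg; exact: is_deriveD. Qed.

Lemma is_derive_mulf f g x v a b : is_derive x v f a -> is_derive x v g b ->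
  is_derive x v (fun y => f y * g y) (a * g x + f x * b).
Proof.
move=> df dg; have := is_deriveM df dg; rewrite addrC.
by move/is_derive_eq; apply; rewrite /GRing.scale /= mulrC.
Qed.

Lemma is_derive_val1 f x v a : is_derive x v f a -> 'D_v f x = a.
Proof. by case. Qed.

Lemma is_derive_funext f v (df : V -> R) :
  (forall y, is_derive y v f (df y)) -> 'D_v f = df.
Proof. by move=> h; apply/funext => y; exact: is_derive_val1. Qed.

Lemma is_derive_derivable f x v a : is_derive x v f a -> derivable f x v.
Proof. by case. Qed.

Lemma Ck_on_sub (U W : set V) k f : U `<=` W -> Ck_on W k f -> Ck_on U k f.
Proof.
move=> UW; elim: k f => [|k IH] f [cf df]; split=> //.
- by move=> x /UW; exact: cf.
- by move=> x /UW; exact: cf.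
- by move=> v; have [dv /IH ?] := df v; split => // x /UW; exact: dv.
Qed.

Lemma Ck_onS k f : Ck_on setT k.+1 f -> Ck_on setT k f.
Proof.
elim: k f => [|k IH] f [cf df]; split=> // v.
by have [dv /IH] := df v.
Qed.

Lemma Ck_on_continuous k f : Ck_on setT k f -> continuous f.
Proof. by case: k => [|k] [cf _] x; exact: cf. Qed.

Lemma Ck_on_cst k (a : R) : Ck_on setT k (fun _ : V => a).
Proof.
elim: k a => [|k IH] a; (split; first by move=> x _; exact: cst_continuous) => //.
move=> v; split; first by move=> x _; exact: derivable_cst.
have -> : 'D_v (fun _ : V => a) = fun=> 0.
  by apply: is_derive_funext => y; exact: is_derive_cst.
exact: IH.
Qed.

Lemma Ck_onD k f g : Ck_on setT k f -> Ck_on setT k g ->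
  Ck_on setT k (fun x => f x + g x).
Proof.
elim: k f g => [|k IH] f g [cf df] [cg dg]; split => //.
- by move=> x _; apply: continuousD; [exact: cf|exact: cg].
- by move=> x _; apply: continuousD; [exact: cf|exact: cg].
move=> v; have [dfv cfv] := df v; have [dgv cgv] := dg v.
have E x : is_derive x v (fun x => f x + g x) ('D_v f x + 'D_v g x).
  by apply: is_derive_addf; apply: derivableP; [exact: dfv|exact: dgv].
split; first by move=> x _; exact: is_derive_derivable (E x).
by rewrite (is_derive_funext E); exact: IH.
Qed.

Lemma Ck_onM k f g : Ck_on setT k f -> Ck_on setT k g ->
  Ck_on setT k (fun x => f x * g x).
Proof.
elim: k f g => [|k IH] f g [cf df] [cg dg]; split => //.
- by move=> x _; apply: continuousM; [exact: cf|exact: cg].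
- by move=> x _; apply: continuousM; [exact: cf|exact: cg].
move=> v; have [dfv cfv] := df v; have [dgv cgv] := dg v.
have E x : is_derive x v (fun x => f x * g x) ('D_v f x * g x + f x * 'D_v g x).
  by apply: is_derive_mulf; apply: derivableP; [exact: dfv|exact: dgv].
split; first by move=> x _; exact: is_derive_derivable (E x).
rewrite (is_derive_funext E); apply: Ck_onD; apply: IH => //;
  by apply: Ck_onS.
Qed.

Lemma Ck_on_sum k n (F : 'I_n -> V -> R) : (forall i, Ck_on setT k (F i)) ->
  Ck_on setT k (fun x => \sum_(i < n) F i x).
Proof.
elim: n F => [|n IH] F HF.
  by under eq_fun do rewrite big_ord0; exact: Ck_on_cst.
under eq_fun do rewrite big_ord_recr /=.
by apply: Ck_onD => //; exact: IH.
Qed.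

Lemma Ck_onX k f n : Ck_on setT k f -> Ck_on setT k (fun x => f x ^+ n).
Proof.
move=> hf; elim: n => [|n IH].
  by under eq_fun do rewrite expr0; exact: Ck_on_cst.
by under eq_fun do rewrite exprS; exact: Ck_onM.
Qed.

(** The chain rule only needs the outer function to be smooth along the values
of the inner one; this is what allows outer functions, such as negative powers,
that are smooth on a half-line only. *)
Lemma Ck_on_comp k (F F1 : R -> R) s : Ck_on setT k.+1 s ->
  (forall x, is_derive (s x) 1 F (F1 (s x))) ->
  Ck_on setT k (fun x => F1 (s x)) -> Ck_on setT k.+1 (fun x => F (s x)).
Proof.
move=> hs dF hF1; have cs := Ck_on_continuous hs; split.
  move=> x _; apply: (@continuous_comp _ _ _ s F); first exact: cs.
  by apply/differentiable_continuous/derivable1_diffP; have [] := dF x.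
move=> v; have [_ /(_ v)[dsv csv]] := hs.
have E x : is_derive x v (fun x => F (s x)) (F1 (s x) * 'D_v s x).
  by apply: is_derive_comp_line => //; apply: derivableP; exact: dsv.
split; first by move=> x _; exact: is_derive_derivable (E x).
by rewrite (is_derive_funext E); exact: Ck_onM.
Qed.

End directional_calculus.

(** The hypothesis is linearity in unbundled form, which fits coordinates and
projections of a product directly. *)
Lemma Ck_on_linear (R : realType) (V : normedModType R) k (f : V -> R) :
  continuous f ->
  (forall h x v, f (h *: v + x) = h * f v + f x) -> Ck_on setT k f.
Proof.
move=> cf lf; case: k => [|k]; first by split => // x _; exact: cf.
split; first by move=> x _; exact: cf.
move=> v; have E x : is_derive x v f (f v).
  apply/is_derive_line; under eq_fun do rewrite lf.
  have := is_derive_addf (is_derive_mulf (is_derive_id (0 : R) 1)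
    (is_derive_cst (f v) (0 : R) (1 : R))) (is_derive_cst (f x) (0 : R) (1 : R)).
  by rewrite /= mulr0 !addr0 mul1r.
split; first by move=> x _; exact: is_derive_derivable (E x).
by rewrite (is_derive_funext E); exact: Ck_on_cst.
Qed.


(** * Euclidean distance *)

Section euclidean.
Context {R : realType} {N : nat}.
Implicit Types (x y c v : 'rV[R]_N).

Definition sqdist c x : R := dotrV (x - c) (x - c).

Lemma dotrV_ge0 x : 0 <= dotrV x x.
Proof. by apply: sumr_ge0 => i _; rewrite -expr2 sqr_ge0. Qed.

Lemma sqdist_ge0 c x : 0 <= sqdist c x. Proof. exact: dotrV_ge0. Qed.

Lemma enorm_ge0 x : 0 <= enorm x. Proof. exact: sqrtr_ge0. Qed.

Lemma sqr_enorm x : enorm x ^+ 2 = dotrV x x.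
Proof. by rewrite sqr_sqrtr// dotrV_ge0. Qed.

Lemma sqdistE c x : sqdist c x = enorm (x - c) ^+ 2.
Proof. by rewrite sqr_enorm. Qed.

Lemma dotrVZ (a b : R) x y : dotrV (a *: x) (b *: y) = a * b * dotrV x y.
Proof. by rewrite /dotrV mulr_sumr; apply: eq_bigr => i _; rewrite !mxE; ring. Qed.

Lemma enormZ (a : R) x : enorm (a *: x) = `|a| * enorm x.
Proof.
by rewrite /enorm dotrVZ sqrtrM -expr2 ?sqr_ge0// sqrtr_sqr.
Qed.

Lemma enorm0 : enorm (0 : 'rV[R]_N) = 0.
Proof. by rewrite -(scale0r 0) enormZ normr0 mul0r. Qed.

Lemma ler_coord_enorm x i : `|x ord0 i| <= enorm x.
Proof.
rewrite -sqrtr_sqr ler_wsqrtr// /dotrV (bigD1 i)//= -expr2 lerDl.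
by apply: sumr_ge0 => j _; rewrite -expr2 sqr_ge0.
Qed.

Lemma enorm_eq0 x : (enorm x == 0) = (x == 0).
Proof.
apply/eqP/eqP => [x0|->]; last exact: enorm0.
apply/rowP => i; rewrite mxE; apply/eqP.
by rewrite -normr_le0 -x0 ler_coord_enorm.
Qed.

Lemma enorm_gt0 x : (0 < enorm x) = (x != 0).
Proof. by rewrite lt_neqAle enorm_ge0 andbT eq_sym enorm_eq0. Qed.

Lemma sqdist_gt0 c x : (0 < sqdist c x) = (x != c).
Proof.
by rewrite sqdistE exprn_even_gt0//= enorm_eq0 subr_eq0.
Qed.

(** The topology comes from the sup norm; the next two bounds transfer
boundedness and smallness between the two norms. *)
Lemma ler_norm_enorm x : `|x| <= enorm x.
Proof.
rewrite [`|x|]mx_normrE; apply/bigmax_leP; split; first exact: enorm_ge0.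
by move=> [i j] _ /=; rewrite ord1; exact: ler_coord_enorm.
Qed.

Lemma ler_enorm_norm x : enorm x <= N%:R * `|x|.
Proof.
rewrite -ler_sqr ?nnegrE ?enorm_ge0 ?mulr_ge0// sqr_enorm /dotrV.
apply: (@le_trans _ _ (\sum_(i < N) `|x| ^+ 2)).
  apply: ler_sum => i _; rewrite -expr2 -real_normK ?num_real// ler_sqr ?nnegrE//.
  by rewrite [`|x|]mx_normrE (le_bigmax _ (fun ij => `|x ij.1 ij.2|) (ord0, i)).
rewrite sumr_const card_ord -[_ *+ N]mulr_natl exprMn ler_wpM2r ?sqr_ge0//.
rewrite -natrX ler_nat; case: N => // k; by rewrite expnS leq_pmulr.
Qed.

Lemma is_derive_coord x v (i : 'I_N) : is_derive x v (fun y => y ord0 i) (v ord0 i).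
Proof.
have h : forall (h : R) y w, (h *: w + y) ord0 i = h * w ord0 i + y ord0 i.
  by move=> h y w; rewrite !mxE.
apply/is_derive_line; under eq_fun do rewrite h.
have := is_derive_addf (is_derive_mulf (is_derive_id (0 : R) 1)
    (is_derive_cst (v ord0 i) (0 : R) (1 : R))) (is_derive_cst (x ord0 i) (0 : R) (1 : R)).
by rewrite /= mulr0 !addr0 mul1r.
Qed.

Lemma is_derive_subcoord c x v (i : 'I_N) :
  is_derive x v (fun y => (y - c) ord0 i) (v ord0 i).
Proof.
rewrite [X in is_derive _ _ X](_ : _ = fun y => y ord0 i + (- c ord0 i)); last first.
  by apply/funext => y; rewrite !mxE.
rewrite -[X in is_derive _ _ _ X]addr0.
exact: (is_derive_addf (is_derive_coord _ _ _) (is_derive_cst _ _ _)).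
Qed.

Lemma is_derive_sqdist c x v : is_derive x v (sqdist c) (2 * dotrV (x - c) v).
Proof.
rewrite [X in is_derive _ _ X _](_ : _ =
    \sum_(i < N) (fun y => (y - c) ord0 i * (y - c) ord0 i)); last first.
  by apply/funext => y; rewrite fct_sumE.
rewrite (_ : 2 * _ = \sum_(i < N)
   (v ord0 i * (x - c) ord0 i + (x - c) ord0 i * v ord0 i)); last first.
  by rewrite /dotrV mulr_sumr; apply: eq_bigr => i _; ring.
apply: is_derive_sum => i.
exact: (is_derive_mulf (is_derive_subcoord _ _ _ _) (is_derive_subcoord _ _ _ _)).
Qed.

Lemma Ck_on_sqdist (V : normedModType R) (L : V -> 'rV[R]_N) k c :
  continuous L -> (forall (h : R) (x v : V), L (h *: v + x) = h *: L v + L x) ->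
  Ck_on setT k (fun z => sqdist c (L z)).
Proof.
move=> cL linL; apply: Ck_on_sum => i.
have h : Ck_on setT k (fun z => (L z - c) ord0 i).
  rewrite [X in Ck_on _ _ X](_ : _ = fun z => L z ord0 i + (- c ord0 i)).
    apply: Ck_onD; last exact: Ck_on_cst.
    apply: Ck_on_linear; last by move=> h x v; rewrite linL !mxE.
    move=> z; apply: (@continuous_comp _ _ _ L (fun y : 'rV[R]_N => y ord0 i)).
      exact: cL.
    exact: coord_continuous.
  by apply/funext => z; rewrite !mxE.
exact: Ck_onM.
Qed.

Lemma continuous_sqdist c : continuous (sqdist c).
Proof.
by apply: Ck_on_continuous; apply: (@Ck_on_sqdist _ id 0 c) => // x; exact: cvg_id.
Qed.

Lemma dotrV_delta x (i : 'I_N) : dotrV x (delta_mx ord0 i) = x ord0 i.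
Proof.
rewrite /dotrV (bigD1 i)//= mxE !eqxx mulr1 big1 ?addr0// => j ji.
by rewrite mxE (negbTE ji) mulr0.
Qed.

Lemma compact_preimage_sqdist c (A : set R) b : closed A -> A `<=` [set r | r <= b] ->
  compact [set x | A (sqdist c x)].
Proof.
move=> cA Ab; apply: bounded_closed_compact.
  exists (`|c| + `|b| + 1); split; first exact: num_real.
  move=> M hM x /= /Ab /=; rewrite sqdistE => h; apply: ltW; apply: le_lt_trans hM.
  rewrite -(subrK c x) addrC (le_trans (ler_normD _ _))// -addrA lerD2l.
  apply: (le_trans (ler_norm_enorm _)).
  have := enorm_ge0 (x - c); move: h; set e := enorm _ => h e0.
  have : e ^+ 2 <= `|b| by apply: (le_trans h); exact: ler_norm.
  by have := sqr_ge0 (e - 1); nra.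
apply: (@closed_comp _ _ (sqdist c)) => // x _; exact: continuous_sqdist.
Qed.

End euclidean.

(** * The p-Laplacian of radial functions *)

(** Radial profiles are only evaluated at nonnegative arguments, so that profiles
such as [(1 + s) `^ (- nu)] qualify. *)
Definition C2_profile (R : realType) (F F1 F2 : R -> R) :=
  forall s : R, 0 <= s ->
    [/\ is_derive s 1 F (F1 s), is_derive s 1 F1 (F2 s) & {for s, continuous F2}].

Section radial.
Context {R : realType} {N : nat} (m : nat) (c : 'rV[R]_N).
Implicit Types (x v : 'rV[R]_N) (F : R -> R) (s : R).

(** The power [m] makes the function flat at its centre while keeping it a smooth
function of the coordinates. *)
Definition radial F x : R := F (sqdist c x ^+ m).

(** The gradient of [radial F] is this multiple of [x - c]. *)
Definition radial_slope F1 s : R := 2 * m%:R * s ^+ m.-1 * F1 (s ^+ m).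

Lemma C2_profile_at F F1 F2 x : C2_profile F F1 F2 ->
  is_derive (sqdist c x ^+ m) 1 F (F1 (sqdist c x ^+ m)).
Proof. by move=> /(_ _ (exprn_ge0 m (sqdist_ge0 c x)))[]. Qed.

Lemma is_derive_expr (s : R) n : is_derive s 1 (fun r => r ^+ n) (n%:R * s ^+ n.-1).
Proof.
have := @is_deriveX _ _ id n s 1 1 (is_derive_id _ _).
by rewrite exprfctE /GRing.scale /= mulr1.
Qed.

Lemma is_derive_radial F F1 x v :
  is_derive (sqdist c x ^+ m) 1 F (F1 (sqdist c x ^+ m)) ->
  is_derive x v (radial F) (radial_slope F1 (sqdist c x) * dotrV (x - c) v).
Proof.
move=> dF; apply: is_derive_eq.
  apply: (@is_derive_comp_line _ _ F) => //.
  apply: (@is_derive_comp_line _ _ (fun r => r ^+ m)).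
    exact: is_derive_expr.
  exact: is_derive_sqdist.
by rewrite /radial_slope; ring.
Qed.

Lemma grad_radial F F1 x :
  is_derive (sqdist c x ^+ m) 1 F (F1 (sqdist c x ^+ m)) ->
  grad (radial F) x = radial_slope F1 (sqdist c x) *: (x - c).
Proof.
move=> dF; apply/rowP => i; rewrite /grad mxE.
by rewrite (is_derive_val1 (is_derive_radial _ dF)) dotrV_delta !mxE.
Qed.

Lemma enorm_grad_radial F F1 x :
  is_derive (sqdist c x ^+ m) 1 F (F1 (sqdist c x ^+ m)) ->
  enorm (grad (radial F) x) =
    2 * m%:R * enorm (x - c) ^+ (2 * m.-1).+1 * `|F1 (sqdist c x ^+ m)|.
Proof.
move=> dF; rewrite (grad_radial dF) enormZ /radial_slope !normrM normrX.
rewrite (ger0_norm (sqdist_ge0 _ _)) !(ger0_norm (ler0n _ _)) sqdistE.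
by rewrite [_ ^+ (2 * _).+1]exprS exprM; ring.
Qed.

Lemma is_derive_slope F1 F2 s : (1 < m)%N ->
  is_derive (s ^+ m) 1 F1 (F2 (s ^+ m)) ->
  is_derive s 1 (radial_slope F1) (2 * m%:R * ((m%:R - 1) * s ^+ m.-2 * F1 (s ^+ m)
    + s ^+ m.-1 * (m%:R * s ^+ m.-1) * F2 (s ^+ m))).
Proof.
move=> m1 dF.
have dm := @is_derive_comp_line R R F1 (fun r : R => r ^+ m) s 1 _ _ dF (is_derive_expr s m).
have := is_derive_mulf (is_derive_mulf (is_derive_cst (2 * m%:R : R) s (1 : R))
  (is_derive_expr s m.-1)) dm.
move/is_derive_eq; apply; rewrite /=.
by case: m m1 => [|[|k]] //= _; rewrite -natr1; ring.
Qed.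

(** The flux is [H (sqdist c y) *: (y - c)] with [H] as below, and its divergence
is [N H + 2 s H'] at [s = sqdist c x]. *)
Lemma p_laplacian_radial (p : R) F F1 F2 x : (1 < m)%N -> x != c ->
  C2_profile F F1 F2 -> F1 (sqdist c x ^+ m) != 0 ->
  p_laplacian p (radial F) x =
    enorm (grad (radial F) x) `^ (p - 2) * (2 * m%:R * sqdist c x ^+ m.-1) *
    ((N%:R + p - 2 + 2 * (p - 1) * (m%:R - 1)) * F1 (sqdist c x ^+ m)
      + 2 * (p - 1) * m%:R * sqdist c x ^+ m * F2 (sqdist c x ^+ m)).
Proof.
move=> m1 xc hF F1n0.
have dF y : is_derive (sqdist c y ^+ m) 1 F (F1 (sqdist c y ^+ m)).
  by have [] := hF _ (exprn_ge0 m (sqdist_ge0 c y)).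
have dF1 y : is_derive (sqdist c y ^+ m) 1 F1 (F2 (sqdist c y ^+ m)).
  by have [] := hF _ (exprn_ge0 m (sqdist_ge0 c y)).
set P := radial_slope F1.
pose X s := P s * P s * s.
pose e := 2^-1 * (p - 2).
pose H s := X s `^ e * P s.
have enX y : enorm (grad (radial F) y) `^ (p - 2) = X (sqdist c y) `^ e.
  rewrite (grad_radial (dF y)) enormZ /e powRrM powR12_sqrt; last first.
    by rewrite /X mulr_ge0 ?sqdist_ge0// -expr2 sqr_ge0.
  by rewrite /X sqrtrM -?expr2 ?sqr_ge0// sqrtr_sqr.
have Fl y (i : 'I_N) : p_flux p (grad (radial F) y) ord0 i = H (sqdist c y) * (y - c) ord0 i.
  by rewrite /p_flux mxE enX (grad_radial (dF y)) mxE /H mulrA.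
set s := sqdist c x.
have s0 : 0 < s by rewrite /s sqdist_gt0.
have m0 : 0 < m%:R :> R by rewrite ltr0n (ltn_trans _ m1).
have Pn0 : P s != 0.
  by rewrite /P /radial_slope !mulf_neq0 ?F1n0// ?expf_neq0 ?(gt_eqF s0)// ?gt_eqF.
have X0 : 0 < X s by rewrite /X mulr_gt0// -expr2 exprn_even_gt0//=.
pose P1 := (2 * m%:R * ((m%:R - 1) * s ^+ m.-2 * F1 (s ^+ m)
    + s ^+ m.-1 * (m%:R * s ^+ m.-1) * F2 (s ^+ m))).
have dP : is_derive s 1 P P1 by exact: is_derive_slope (dF1 x).
have dX : is_derive s 1 X (2 * P s * P1 * s + P s * P s).
  have := is_derive_mulf (is_derive_mulf dP dP) (is_derive_id s 1).
  by move/is_derive_eq; apply; rewrite /=; ring.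
have dXe := @is_derive_comp_line R R (fun r : R => r `^ e) X s 1 _ _ (is_derive1_powR e X0) dX.
have dH := is_derive_mulf dXe dP.
rewrite -/(H) in dH.
have D1 (i : 'I_N) : (delta_mx ord0 i : 'rV[R]_N) ord0 i = 1 by rewrite mxE !eqxx.
rewrite /p_laplacian /divergence.
under eq_bigr => i _.
  have -> : (fun y => p_flux p (grad (radial F) y) ord0 i) =
     fun y => H (sqdist c y) * (y - c) ord0 i by apply/funext => y; exact: Fl.
  rewrite (is_derive_val1 (is_derive_mulf (@is_derive_comp_line _ _ H (sqdist c) x (delta_mx ord0 i) _ _ dH (is_derive_sqdist _ _ _))
    (is_derive_subcoord _ _ _ _))) dotrV_delta -/s (D1 i).
  over.
rewrite big_split/= sumr_const card_ord mulr1 -[_ *+ N]mulr_natr.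
rewrite (eq_bigr (fun i => (e * X s `^ (e - 1) * (2 * P s * P1 * s + P s * P s) * P s
   + X s `^ e * P1) * 2 * ((x - c) ord0 i * (x - c) ord0 i))); last first.
  by move=> i _; ring.
rewrite -mulr_sumr -/(dotrV (x - c) (x - c)) -/(sqdist c x) -/s enX -/s /H.
have XE : X s `^ (e - 1) = X s `^ e / X s.
  by rewrite powRB ?(gt_eqF X0) ?implybT// powRr1// ltW.
rewrite XE.
have -> : e * (X s `^ e / X s) * (2 * P s * P1 * s + P s * P s) * P s
  = X s `^ e * e * (2 * P1 + P s / s).
  by rewrite {2}/X; field; rewrite Pn0 gt_eqF.
have sP1 : s * P1 = 2 * m%:R * s ^+ m.-1 *
    ((m%:R - 1) * F1 (s ^+ m) + m%:R * s ^+ m * F2 (s ^+ m)).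
  rewrite /P1; case: (m) m1 => [|[|k]] //= _; rewrite !exprS; ring.
have -> : (X s `^ e * e * (2 * P1 + P s / s) + X s `^ e * P1) * 2 * s
   = X s `^ e * (4 * e * (s * P1) + 2 * e * P s + 2 * (s * P1)).
  by field; rewrite gt_eqF.
by rewrite sP1 /P /radial_slope /e; field.
Qed.

End radial.

(** The form used for barriers: |grad|^(p-1) / r is the size of the diffusion
term, and the last factor only depends on the logarithmic derivative of the slope
of the profile. *)
Lemma p_laplacian_radial_sg (R : realType) (N m : nat) (c : 'rV[R]_N) (p : R)
    (F F1 F2 : R -> R) (x : 'rV[R]_N) :
  (1 < m)%N -> x != c -> C2_profile F F1 F2 -> F1 (sqdist c x ^+ m) != 0 ->
  p_laplacian p (radial m c F) x =
    Num.sg (F1 (sqdist c x ^+ m)) *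
    (enorm (grad (radial m c F) x) `^ (p - 1) / enorm (x - c)) *
    (N%:R + p - 2 + 2 * (p - 1) * (m%:R - 1) + 2 * (p - 1) * m%:R *
      (sqdist c x ^+ m * F2 (sqdist c x ^+ m) / F1 (sqdist c x ^+ m))).
Proof.
move=> m1 xc hF F1n0; rewrite (p_laplacian_radial p m1 xc hF F1n0).
set s := sqdist c x ^+ m in F1n0 *.
set r := enorm (x - c); have r0 : 0 < r by rewrite enorm_gt0 subr_eq0.
have gE := enorm_grad_radial (C2_profile_at m c x hF).
rewrite -/s -/r in gE; set g := enorm (grad (radial m c F) x) in gE *.
have g0 : 0 < g.
  by rewrite gE !mulr_gt0 ?exprn_gt0 ?normr_gt0// ltr0n (ltn_trans _ m1).
have -> : g `^ (p - 2) = g `^ (p - 1) / g.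
  have -> : p - 2 = (p - 1) - 1 by ring.
  by rewrite powRB ?(gt_eqF g0) ?implybT// powRr1// ltW.
have gE' : g = r * (2 * m%:R * sqdist c x ^+ m.-1) * `|F1 s|.
  by rewrite gE sqdistE -/r [_ ^+ (2 * _).+1]exprS exprM; ring.
have m0 : m%:R != 0 :> R by rewrite pnatr_eq0 -lt0n (ltn_trans _ m1).
have d0 : sqdist c x ^+ m.-1 != 0 by rewrite expf_neq0// gt_eqF// sqdist_gt0.
have nF0 : `|F1 s| != 0 by rewrite normr_eq0.
have sgE : Num.sg (F1 s) = F1 s / `|F1 s|.
  by rewrite {2}[F1 s]numEsg mulfK.
set G := g `^ (p - 1); rewrite gE' sgE.
field.
by rewrite F1n0 m0 d0 nF0 gt_eqF.
Qed.

(** * Comparison on compact cylinders *)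

Section interior_maximum.
Context {R : realType} {T : topologicalType}.

(** A function that is nonpositive on the parabolic boundary but positive somewhere
attains, after a penalization increasing in time, its maximum at an interior
point.  The penalization is small at the given point but exceeds the maximum at
the final time, which is thereby excluded. *)
Lemma interior_maximum (v : R * T -> R) (t1 t2 : R) (D Do : set T) (ts : R) (xs : T) :
  compact D -> open Do -> Do `<=` D ->
  {within `[t1, t2] `*` D, continuous v} ->
  (forall x, D x -> v (t1, x) <= 0) ->
  (forall t x, t1 <= t <= t2 -> D x -> ~ Do x -> v (t, x) <= 0) ->
  t1 <= ts <= t2 -> D xs -> 0 < v (ts, xs) ->
  exists (e L t : R) (x : T), [/\ 0 < e, 0 < L, t1 < t < t2, Do x &
    \forall z \near (t, x), v z - e * expR (L * z.1) <= v (t, x) - e * expR (L * t)].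
Proof.
move=> cD oDo DoD cv v1 vD tsI Dxs vs.
(* The final time is the limit of earlier ones. *)
wlog tst2 : ts tsI vs / ts < t2.
  move=> wl; have [|tst2] := ltP ts t2; first exact: wl.
  have E : ts = t2 by apply/eqP; rewrite eq_le tst2 andbT; case/andP: tsI.
  have /(_ (ts, xs)) h := (subspace_continuousP _ _).1 cv.
  have {h} : v y @[y --> within (`[t1, t2] `*` D) (nbhs (ts, xs))] --> v (ts, xs).
    by apply: h; split => //=; rewrite in_itv.
  move=> /cvgr_gt /(_ _ vs); rewrite near_withinE => h.
  have {h} : \forall s \near ts, (`[t1, t2] `*` D) (s, xs) -> 0 < v (s, xs).
    have c : (s, xs) @[s --> ts] --> (ts, xs).
      exact: (@cvg_pair _ _ _ (nbhs ts) (nbhs ts) (nbhs xs) _ _ _ id (cst xs) cvg_id (cvg_cst xs)).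
    exact: (c [set z | (`[t1, t2] `*` D) z -> 0 < v z] h).
  move=> /nbhs_ballP[d /= d0 hd].
  have t1ts : t1 < ts.
    rewrite lt_neqAle (andP tsI).1 andbT; apply/eqP => t1s.
    by have := v1 _ Dxs; rewrite t1s leNgt vs.
  pose s := Num.max t1 (ts - d / 2).
  have sI : t1 <= s < ts.
    by rewrite /s le_max lexx/= gt_max t1ts/= ltrBlDr ltrDl divr_gt0.
  apply: (wl s).
  - by rewrite (andP sI).1 -E ltW// (andP sI).2.
  - apply: hd; last by split => //=; rewrite in_itv/= (andP sI).1 -E ltW// (andP sI).2.
    rewrite /ball/= ger0_norm ?subr_ge0 ?ltW ?(andP sI).2//.
    rewrite ltrBlDr -ltrBlDl lt_max; apply/orP; right.
    by rewrite ltrD2l ltrN2 ltr_pdivrMr// mulr2n mulrDr mulr1 ltrDl.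
  - by rewrite -E (andP sI).2.
have t1t2 : t1 <= t2 by case/andP: tsI; exact: le_trans.
have cA : compact (`[t1, t2] `*` D) by apply: compact_setX => //; exact: segment_compact.
have As : (`[t1, t2] `*` D) (ts, xs) by split => //=; rewrite in_itv.
have [M hM] : exists M, forall z, (`[t1, t2] `*` D) z -> v z <= M.
  have [z0 _ hz0] := compact_EVT_max (ex_intro _ _ As) cA cv.
  by exists (v z0) => z Az; apply: hz0; rewrite inE.
(* The penalization is half the given positive value at time [ts], and at least
   [e0 * (1 + L * (t2 - ts)) > M] at time [t2]. *)
pose e0 := v (ts, xs) / 2.
have e00 : 0 < e0 by rewrite divr_gt0.
pose L := (`|M| + 1) / (e0 * (t2 - ts)).
have L0 : 0 < L by rewrite divr_gt0 ?mulr_gt0 ?subr_gt0// ltr_wpDl.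
pose e := e0 * expR (- (L * ts)).
have e_gt0 : 0 < e by rewrite mulr_gt0// expR_gt0.
pose w z := v z - e * expR (L * z.1).
have eE t : e * expR (L * t) = e0 * expR (L * (t - ts)).
  by rewrite /e -mulrA -expRD; congr (_ * expR _); ring.
have cw : {within `[t1, t2] `*` D, continuous w}.
  apply/subspace_continuousP => z Az; rewrite /w; apply: cvgB.
    exact: (subspace_continuousP _ _).1 cv _ Az.
  apply: cvg_within_filter.
  have ce : {for z.1, continuous (fun s => e * expR (L * s))}.
    apply: continuousM; first exact: cst_continuous.
    apply: (@continuous_comp _ _ _ (fun s => L * s) expR).
      by apply: continuousM; [exact: cst_continuous|exact: cvg_id].
    exact: continuous_expR.
  apply: (@continuous_comp _ _ _ (@fst R T) (fun s => e * expR (L * s))) ce.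
  exact: cvg_fst.
have [[t x] ] := compact_EVT_max (ex_intro _ _ As) cA cw.
rewrite inE => -[/= tI Dx] hmax.
have tI' : t1 <= t <= t2 by move: tI; rewrite in_itv.
have w0 : 0 < w (t, x).
  have := hmax (ts, xs); rewrite inE => /(_ As); apply: lt_le_trans.
  by rewrite /w eE subrr mulr0 expR0 mulr1 /e0; lra.
have vt0 : 0 < v (t, x).
  by apply: (lt_trans w0); rewrite /w/= ltrBlDr ltrDl mulr_gt0// expR_gt0.
have tt1 : t1 < t.
  rewrite lt_neqAle (andP tI').1 andbT; apply/eqP => t1E.
  by have := v1 _ Dx; rewrite t1E leNgt vt0.
have tt2 : t < t2.
  rewrite lt_neqAle (andP tI').2 andbT; apply/eqP => tE.
  move: w0; rewrite /w/= eE tE ltNge => /negP; apply.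
  rewrite subr_le0; apply: (@le_trans _ _ M); first by have := hM (t, x) (conj tI Dx); rewrite tE.
  apply: (@le_trans _ _ (e0 * (1 + L * (t2 - ts)))); last first.
    by rewrite ler_pM2l// expR_ge1Dx.
  rewrite mulrDr /L mulr1.
  have -> : e0 * ((`|M| + 1) / (e0 * (t2 - ts)) * (t2 - ts)) = `|M| + 1.
    by field; rewrite subr_eq0 !gt_eqF.
  by have := ler_norm M; lra.
have Dox : Do x by apply/not_notP => nDo; have := vD _ _ tI' Dx nDo; rewrite leNgt vt0.
exists e, L, t, x; split => //; first by rewrite tt1.
have nt : \forall z \near (t, x), (`[t1, t2] `*` D) z.
  exists (`]t1, t2[%classic, Do); last by move=> -[s y] [/= sI /DoD ?]; split => //=;
    exact: subset_itv_oo_cc sI.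
  split => /=; last exact: open_nbhs_nbhs.
  by apply: near_in_itvoo; rewrite in_itv/= tt1.
by apply: filterS nt => z Az; apply: hmax; rewrite inE.
Qed.

End interior_maximum.

Section admissible_barriers.
Context {R : realType} {N : nat} (p : R) (m : nat) (c : 'rV[R]_N).
Hypothesis m1 : (1 < m)%N.
(** Flatness required by [profile]: for f(r) = r^(2m) this is what makes
f'^(p-2) f'' tend to 0. *)
Hypothesis mp : 1 < (2 * m%:R - 1) * (p - 1).
Implicit Types (F : R -> R) (s t : R) (x : 'rV[R]_N).

(** The exponential is the penalization of [interior_maximum]. *)
Definition barrier F (l t1 e L : R) (z : R * 'rV[R]_N) : R :=
  radial m c F z.2 + (l * (z.1 - t1) + e * expR (L * z.1)).

Lemma profile_expr (C : R) : 0 < C -> profile p (fun r => C * r ^+ (2 * m)).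
Proof.
move=> C0; set n := (2 * m)%N.
have n4 : (3 < n)%N by rewrite /n; case: m m1 => [|[|k]] // _; rewrite !mulnS.
have np : 1 < (n%:R - 1) * (p - 1) by rewrite /n natrM.
have dX (b : R) (k : nat) (r : R) :
    is_derive r 1 (fun r => b * r ^+ k) (b * k%:R * r ^+ k.-1).
  have := is_derive_mulf (is_derive_cst b r (1 : R)) (is_derive_expr r k).
  by move/is_derive_eq; apply; rewrite /=; ring.
have d1 (b : R) k : derive1 (fun r => b * r ^+ k) = fun r => b * k%:R * r ^+ k.-1.
  by apply/funext => r; rewrite derive1E; exact: is_derive_val1 (dX b k r).
have d2 : derive1n 2 (fun r => C * r ^+ n) = fun r => C * n%:R * n.-1%:R * r ^+ n.-2.
  by rewrite derive1nS derive1n1 !d1.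
split.
  apply: Ck_onM; first exact: Ck_on_cst.
  apply: (@Ck_onX _ _ _ id); apply: Ck_on_linear => // r; exact: cvg_id.
rewrite d2 d1; case: (n) n4 np => [|[|[|k]]]//= k0 kp; split.
- by rewrite expr0n mulr0.
- by rewrite expr0n mulr0.
- by rewrite expr0n/= mulr0.
- by move=> r r0; rewrite !mulr_gt0// exprn_gt0.
pose a := k.+2%:R * (p - 2) + k.+1%:R.
have a0 : 0 < a.
  have e3 : k.+3%:R = k.+2%:R + 1 :> R by rewrite natr1.
  have e2 : k.+2%:R = k.+1%:R + 1 :> R by rewrite natr1.
  by move: kp; rewrite /a e3 e2; lra.
pose K := (C * k.+3%:R) `^ (p - 2) * (C * k.+3%:R * k.+2%:R).
have h : K * r `^ a @[r --> 0^'+] --> 0.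
  rewrite -[X in _ --> X](mulr0 K); apply: cvgM; first exact: cvg_cst.
  exact: powR_cvg0.
apply: cvg_trans h; apply: near_eq_cvg; near=> r.
have r0 : 0 < r by [].
have Cr : 0 <= C * k.+3%:R * r ^+ k.+2.
  apply: mulr_ge0; last exact: exprn_ge0 (ltW r0).
  by apply: mulr_ge0; [exact: ltW|exact: ler0n].
rewrite (ger0_norm Cr).
rewrite powRM; last 2 first.
- by apply: mulr_ge0; [exact: ltW|exact: ler0n].
- exact: exprn_ge0 (ltW r0).
rewrite -(powR_mulrn k.+2 (ltW r0)) -powRrM /K /a [r `^ (_ + _)]powRD.
  by rewrite (powR_mulrn _ (ltW r0)); ring.
by rewrite (gt_eqF r0) implybT.
Unshelve. all: by end_near. Qed.

Lemma profile_linear_bound F F1 F2 : C2_profile F F1 F2 ->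
  exists2 d : R, 0 < d & forall s, 0 <= s < d ->
    `|F s - F 0| <= (`|F1 0| + 1) * s.
Proof.
move=> hF; have [[dF dE] _ _] := hF 0 (lexx 0).
have h : h^-1 *: (F (h *: 1 + 0) - F 0) @[h --> 0^'] --> F1 0.
  by rewrite -dE; exact: dF.
have : \forall h \near 0^', `|h^-1 * (F h - F 0)| <= `|F1 0| + 1.
  have /cvg_norm /cvgr_le := h; move=> /(_ (`|F1 0| + 1)); rewrite ltrDl ltr01 => /(_ isT).
  by apply: filterS => k; rewrite /GRing.scale/= mulr1 addr0.
move=> /nbhs_ballP[d /= d0 hd]; exists d => // s /andP[s0 sd].
have [->|sn0] := eqVneq s 0; first by rewrite subrr normr0 mulr0.
have sp : 0 < s by rewrite lt_neqAle eq_sym sn0.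
have := hd s; rewrite /ball/= sub0r normrN ger0_norm// => /(_ sd sn0).
rewrite normrM normfV (ger0_norm s0) ler_pdivrMl//.
by rewrite mulrC.
Qed.

Lemma expR_quadratic_bound (y : R) : `|y| <= 1 / 2 -> `|expR y - 1 - y| <= 2 * y ^+ 2.
Proof.
move=> hy; have := expR_ge1Dx y; have := expR_ge1Dx (- y); rewrite expRN.
have e0 := expR_gt0 y; move: hy; rewrite ler_norml => /andP[y1 y2] h1 h2.
have {h1} h1 : (1 - y) * expR y <= 1 by rewrite -ler_pdivlMr// mul1r.
rewrite ger0_norm; last by lra.
have : (1 - y) * (expR y - 1 - y - 2 * y ^+ 2) <= 0.
  have : 0 <= y ^+ 2 * (1 - 2 * y) by rewrite mulr_ge0 ?sqr_ge0//; lra.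
  by rewrite expr2; lra.
by rewrite pmulr_rle0; lra.
Qed.

Lemma is_derive_barrier_time F (l t1 e L : R) x t :
  is_derive t 1 (fun s => barrier F l t1 e L (s, x)) (l + e * L * expR (L * t)).
Proof.
rewrite /barrier /=.
have dL : is_derive t 1 (fun s => L * s) (L * 1).
  have := is_derive_mulf (is_derive_cst L t (1 : R)) (is_derive_id t (1 : R)).
  by move/is_derive_eq; apply; rewrite /=; ring.
have dE := @is_derive_comp_line R R expR (fun s => L * s) t 1 _ _ (is_derive_expR _) dL.
have dE' := is_derive_mulf (is_derive_cst e t (1 : R)) dE.
have dl := is_derive_mulf (is_derive_cst l t (1 : R))
  (is_derive_addf (is_derive_id t (1 : R)) (is_derive_cst (- t1) t (1 : R))).
have := is_derive_addf (is_derive_cst (radial m c F x) t (1 : R)) (is_derive_addf dl dE').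
by move/is_derive_eq; apply; rewrite /=; ring.
Qed.

Lemma barrier_slice F l t1 e L t :
  slice (barrier F l t1 e L) t = radial m c (fun s => F s + (l * (t - t1) + e * expR (L * t))).
Proof. by []. Qed.

Lemma C2_profileD F F1 F2 (a : R) : C2_profile F F1 F2 -> C2_profile (fun s => F s + a) F1 F2.
Proof.
move=> hF s /hF[d1 d2 c2]; split => //.
have := is_derive_addf d1 (is_derive_cst a s (1 : R)).
by move/is_derive_eq; apply; rewrite addr0.
Qed.

Lemma grad_radial_eq0 F F1 F2 x : C2_profile F F1 F2 ->
  (forall s, 0 <= s -> F1 s != 0) ->
  (grad (radial m c F) x == 0) = (x == c).
Proof.
move=> hF F1n0; rewrite (grad_radial (C2_profile_at m c x hF)) scaler_eq0 subr_eq0.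
have [->|xc] := eqVneq x c; first by rewrite orbT.
rewrite orbF /radial_slope !mulf_eq0 (negbTE (F1n0 _ (exprn_ge0 m (sqdist_ge0 c x)))).
rewrite expf_eq0 (gt_eqF (_ : 0 < sqdist c x)) ?sqdist_gt0// !pnatr_eq0.
by case: m m1 => [|k] //; rewrite andbF.
Qed.

(** The only critical point is the centre.  There the deviation from the first
order expansion in time splits into [F s - F 0], of order |x - c|^(2m), and the
Taylor remainder of the exponential, of order |t - t0|^2. *)
Lemma admissible_barrier F F1 F2 (l t1 e L : R) : C2_profile F F1 F2 ->
  (forall s, 0 <= s -> F1 s != 0) -> admissible p (barrier F l t1 e L).
Proof.
move=> hF F1n0; split.
  apply: (@Ck_on_sub _ _ _ setT) => //.
  have cs k : Ck_on setT k (fun z : R * 'rV[R]_N => sqdist c z.2 ^+ m).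
    apply: Ck_onX; apply: Ck_on_sqdist => // z; exact: cvg_snd.
  have ct k : Ck_on setT k (fun z : R * 'rV[R]_N => z.1).
    by apply: Ck_on_linear => // z; exact: cvg_fst.
  have cL k : Ck_on setT k (fun z : R * 'rV[R]_N => L * z.1).
    by apply: Ck_onM => //; exact: Ck_on_cst.
  apply: Ck_onD; last apply: Ck_onD.
  - have s0 (z : R * 'rV[R]_N) : 0 <= sqdist c z.2 ^+ m by rewrite exprn_ge0 ?sqdist_ge0.
    apply: (@Ck_on_comp _ _ 1 F F1) => //; first by move=> z; have [] := hF _ (s0 z).
    apply: (@Ck_on_comp _ _ 0 F1 F2) => //; first by move=> z; have [] := hF _ (s0 z).
    split => // z _.
    apply: (@continuous_comp _ _ _ (fun z : R * 'rV[R]_N => sqdist c z.2 ^+ m) F2).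
      exact: (Ck_on_continuous (cs 0)).
    by have [] := hF _ (s0 z).
  - apply: Ck_onM; first exact: Ck_on_cst.
    by apply: Ck_onD => //; exact: Ck_on_cst.
  - apply: Ck_onM; first exact: Ck_on_cst.
    apply: (@Ck_on_comp _ _ 1 expR expR) => //; apply: (@Ck_on_comp _ _ 0 expR expR) => //.
    split => // z _; apply: (@continuous_comp _ _ _ (fun z : R * 'rV[R]_N => L * z.1) expR).
      exact: (Ck_on_continuous (cL 0)).
    exact: continuous_expR.
move=> t0 x0 t00; rewrite barrier_slice => /eqP.
rewrite (grad_radial_eq0 _ (C2_profileD _ hF) F1n0) => /eqP ->.
have [d1 d10 hd1] := profile_linear_bound hF.
set C := `|F1 0| + 1 in hd1.
have C0 : 0 < C by rewrite /C ltr_wpDl.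
pose K := `|e| * expR (L * t0) * (2 * L ^+ 2).
have K0 : 0 <= K.
  apply: mulr_ge0; first by apply: mulr_ge0 => //; exact: expR_ge0.
  by apply: mulr_ge0 => //; exact: sqr_ge0.
pose d := Num.min (Num.min 1 d1) (1 / 2 / (`|L| + 1)).
have L0 : 0 < `|L| + 1 by rewrite ltr_wpDl.
exists d, (fun r => C * r ^+ (2 * m)), (fun r => K * r ^+ 2); split.
- by rewrite /d !lt_min ltr01 d10 !divr_gt0.
- exact: profile_expr.
- split.
  + apply: continuous_subspaceT; apply: (@Ck_on_continuous _ _ 0).
    apply: Ck_onM; first exact: Ck_on_cst.
    by apply: (@Ck_onX _ _ _ id); apply: Ck_on_linear => // r; exact: cvg_id.
  + by move=> r r0; rewrite mulr_ge0// sqr_ge0.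
  + have h : K * r @[r --> 0^'+] --> (0 : R).
      rewrite -[X in _ --> X](mulr0 K); apply: cvgM; first exact: cvg_cst.
      by apply: cvg_within_filter; exact: cvg_id.
    apply: cvg_trans h; apply: near_eq_cvg; near=> r.
    have r0 : r != 0 by apply: lt0r_neq0.
    by field.
move=> t x t_gt0 hd.
have xd : enorm (x - c) < d by apply: le_lt_trans hd; rewrite lerDl.
have td : `|t - t0| < d by apply: le_lt_trans hd; rewrite lerDr enorm_ge0.
move: xd; rewrite !lt_min => /andP[/andP[x1 xd1] _].
move: td; rewrite !lt_min => /andP[_ tL].
rewrite /dt (is_derive_val1 (is_derive_barrier_time _ _ _ _ _ _ _)) /barrier /radial /=.
have -> : sqdist c c ^+ m = 0.
  by rewrite sqdistE subrr enorm0 !expr0n/=; case: m m1.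
rewrite sqdistE -exprM.
set s := enorm (x - c) ^+ _.
have s0 : 0 <= s by rewrite exprn_ge0 ?enorm_ge0.
have sd1 : s < d1.
  apply: le_lt_trans xd1; rewrite /s; case: m m1 => [|k] // _.
  rewrite mulnS exprS ler_piMr ?enorm_ge0//.
  by rewrite exprn_ile1 ?enorm_ge0// ltW.
pose y := L * (t - t0).
have Ey : expR (L * t) = expR (L * t0) * expR y by rewrite -expRD /y; congr expR; ring.
have -> : F s + (l * (t - t1) + e * expR (L * t)) - (F 0 + (l * (t0 - t1) + e * expR (L * t0)))
   - (l + e * L * expR (L * t0)) * (t - t0)
   = (F s - F 0) + e * expR (L * t0) * (expR y - 1 - y) by rewrite Ey /y; ring.
apply: (le_trans (ler_normD _ _)); apply: lerD; first by apply: hd1; rewrite s0.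
rewrite !normrM (ger0_norm (expR_ge0 _)).
have hy : `|y| <= 1 / 2.
  rewrite /y normrM; move: tL; rewrite ltr_pdivlMr// mulrDr mulr1 [X in X + _]mulrC.
  by have := normr_ge0 (t - t0); lra.
have -> : K * `|t - t0| ^+ 2 = `|e| * expR (L * t0) * (2 * y ^+ 2).
  by rewrite real_normK ?num_real// /K /y; ring.
by rewrite ler_wpM2l ?mulr_ge0 ?expR_ge0// expR_quadratic_bound.
Unshelve. all: by end_near. Qed.

End admissible_barriers.
Section comparison.
Context {R : realType} {N : nat} (p q : R) (u : R * 'rV[R]_N -> R).
Context (m : nat) (c : 'rV[R]_N).
Hypothesis m1 : (1 < m)%N.
Hypothesis mp : 1 < (2 * m%:R - 1) * (p - 1).
Hypothesis cu : {within [set z : R * 'rV[R]_N | 0 <= z.1], continuous u}.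
Context (F F1 F2 : R -> R).
Hypothesis hF : C2_profile F F1 F2.
Hypothesis F1n0 : forall s, 0 <= s -> F1 s != 0.
Context (D Do : set 'rV[R]_N) (t1 t2 l : R).
Hypotheses (cD : compact D) (oDo : open Do) (DoD : Do `<=` D) (t1_ge0 : 0 <= t1).

Lemma grad_slice_barrier e L t x :
  grad (slice (barrier m c F l t1 e L) t) x = grad (radial m c F) x.
Proof.
rewrite barrier_slice (grad_radial (C2_profile_at m c x (C2_profileD _ hF))).
by rewrite (grad_radial (C2_profile_at m c x hF)).
Qed.

Lemma p_laplacian_slice_barrier e L t x :
  p_laplacian p (slice (barrier m c F l t1 e L) t) x = p_laplacian p (radial m c F) x.
Proof.
by rewrite /p_laplacian; under eq_fun do rewrite grad_slice_barrier.
Qed.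

Lemma continuous_barrier_base :
  continuous (fun z : R * 'rV[R]_N => radial m c F z.2 + l * (z.1 - t1)).
Proof.
move=> z; apply: cvgD.
  apply: (@continuous_comp _ _ _ (fun z : R * 'rV[R]_N => sqdist c z.2 ^+ m) F).
    have h : continuous (fun z : R * 'rV[R]_N => sqdist c z.2 ^+ m); last exact: h.
    apply: (@Ck_on_continuous _ _ 0).
    by apply: Ck_onX; apply: Ck_on_sqdist => // y; exact: cvg_snd.
  apply/differentiable_continuous/derivable1_diffP.
  by have [[]] := hF (exprn_ge0 m (sqdist_ge0 c z.2)).
have h : continuous (fun z : R * 'rV[R]_N => l * (z.1 - t1)); last exact: h.
apply: (@Ck_on_continuous _ _ 0); apply: Ck_onM; first exact: Ck_on_cst.
apply: Ck_onD; last exact: Ck_on_cst.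
by apply: Ck_on_linear => // y; exact: cvg_fst.
Qed.

Let A0 : (`[t1, t2] `*` D) `<=` [set z : R * 'rV[R]_N | 0 <= z.1].
Proof.
by move=> [t x] [/= + _]; rewrite in_itv/= => /andP[+ _]; exact: le_trans.
Qed.

(** At an interior maximum, the time derivative of the test function exceeds [l]
by the positive derivative of the penalization.  The viscosity inequality
contradicts this, through [hl] away from the centre and through [0 <= l] at the
centre. *)
Lemma subsolution_comparison : viscosity_subsolution p q u ->
  (forall x, Do x -> x != c ->
     p_laplacian p (radial m c F) x - enorm (grad (radial m c F) x) `^ q <= l) ->
  (Do c -> 0 <= l) ->
  (forall x, D x -> u (t1, x) <= radial m c F x) ->
  (forall t x, t1 <= t <= t2 -> D x -> ~ Do x ->
     u (t, x) <= radial m c F x + l * (t - t1)) ->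
  forall t x, t1 <= t <= t2 -> D x -> u (t, x) <= radial m c F x + l * (t - t1).
Proof.
move=> sub hl hc h1 hD t x tI Dx; rewrite leNgt; apply/negP => hgt.
pose v z := u z - (radial m c F z.2 + l * (z.1 - t1)).
have cv : {within `[t1, t2] `*` D, continuous v}.
  apply/subspace_continuousP => z Az; rewrite /v; apply: cvgB.
    by have /subspace_continuousP := continuous_subspaceW A0 cu; exact.
  by apply: cvg_within_filter; exact: continuous_barrier_base.
have v1 y : D y -> v (t1, y) <= 0.
  by move=> Dy; rewrite /v/= subrr mulr0 addr0 subr_le0 h1.
have vD s y : t1 <= s <= t2 -> D y -> ~ Do y -> v (s, y) <= 0.
  by move=> sI Dy Doy; rewrite /v/= subr_le0 hD.
have vt : 0 < v (t, x) by rewrite /v/= subr_gt0.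
have [e [L [s [y' [e0 L0 sI Doy hmax]]]]] :=
  interior_maximum cD oDo DoD cv v1 vD tI Dx vt.
pose y : 'rV[R]_N := y'.
have s0 : 0 < s by case/andP: sI => + _; exact: le_lt_trans.
have /(_ s y (admissible_barrier c m1 mp l t1 e L hF F1n0) s0)[|] :=
    sub (barrier m c F l t1 e L).
  by apply: filterS hmax => z; rewrite /v /barrier /=; lra.
rewrite grad_slice_barrier p_laplacian_slice_barrier /dt.
rewrite (is_derive_val1 (is_derive_barrier_time _ _ _ _ _ _ _ _ _)) => hn0 h0.
have lt_l : l < l + e * L * expR (L * s) by rewrite ltrDl !mulr_gt0 ?expR_gt0.
have [yc|yc] := eqVneq y c.
  have /eqP gy0 : grad (radial m c F) y == 0.
    by rewrite (grad_radial_eq0 c m1 _ hF F1n0) yc.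
  have Doc : Do c by rewrite -yc.
  by have := h0 gy0; have := hc Doc; lra.
have := hn0 _; rewrite (grad_radial_eq0 c m1 _ hF F1n0) => /(_ yc).
by have := hl _ Doy yc; lra.
Qed.

(** Same argument with the penalization subtracted.  The centre, where the
gradient of the barrier vanishes, has to lie outside the domain because [l] is
meant to be positive. *)
Lemma supersolution_comparison : viscosity_supersolution p q u ->
  (forall x, Do x -> x != c /\
     l <= p_laplacian p (radial m c F) x - enorm (grad (radial m c F) x) `^ q) ->
  (forall x, D x -> radial m c F x <= u (t1, x)) ->
  (forall t x, t1 <= t <= t2 -> D x -> ~ Do x ->
     radial m c F x + l * (t - t1) <= u (t, x)) ->
  forall t x, t1 <= t <= t2 -> D x -> radial m c F x + l * (t - t1) <= u (t, x).
Proof.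
move=> sup hl h1 hD t x tI Dx; rewrite leNgt; apply/negP => hgt.
pose v z := radial m c F z.2 + l * (z.1 - t1) - u z.
have cv : {within `[t1, t2] `*` D, continuous v}.
  apply/subspace_continuousP => z Az; rewrite /v; apply: cvgB; last first.
    by have /subspace_continuousP := continuous_subspaceW A0 cu; exact.
  by apply: cvg_within_filter; exact: continuous_barrier_base.
have v1 y : D y -> v (t1, y) <= 0.
  by move=> Dy; rewrite /v/= subrr mulr0 addr0 subr_le0 h1.
have vD s y : t1 <= s <= t2 -> D y -> ~ Do y -> v (s, y) <= 0.
  by move=> sI Dy Doy; rewrite /v/= subr_le0 hD.
have vt : 0 < v (t, x) by rewrite /v/= subr_gt0.
have [e [L [s [y' [e0 L0 sI Doy hmax]]]]] :=
  interior_maximum cD oDo DoD cv v1 vD tI Dx vt.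
pose y : 'rV[R]_N := y'.
have s0 : 0 < s by case/andP: sI => + _; exact: le_lt_trans.
have /(_ s y (admissible_barrier c m1 mp l t1 (- e) L hF F1n0) s0)[|] :=
    sup (barrier m c F l t1 (- e) L).
  by apply: filterS hmax => z; rewrite /v /barrier /=; lra.
rewrite grad_slice_barrier p_laplacian_slice_barrier /dt.
rewrite (is_derive_val1 (is_derive_barrier_time _ _ _ _ _ _ _ _ _)) => hn0 _.
have lt_l : 0 < e * L * expR (L * s) by rewrite !mulr_gt0 ?expR_gt0.
have [yc hy] := hl _ Doy.
have := hn0 _; rewrite (grad_radial_eq0 c m1 _ hF F1n0) => /(_ yc).
by lra.
Qed.

End comparison.

(** * Exponential profiles *)

Section exponential_profile.
Context {R : realType} (b k A : R).

Definition exp_profile (s : R) : R := b + k * expR (- (A * s)).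

Lemma C2_profile_exp : C2_profile exp_profile
  (fun s => - (k * A) * expR (- (A * s))) (fun s => k * A ^+ 2 * expR (- (A * s))).
Proof.
have dE (s : R) : is_derive s 1 (fun s => expR (- (A * s))) (- A * expR (- (A * s))).
  have dA : is_derive s 1 (fun s => - (A * s)) (- A).
    rewrite (_ : (fun s => - (A * s)) = fun s => - A * s); last by apply/funext => y; ring.
    have := is_derive_mulf (is_derive_cst (- A) s (1 : R)) (is_derive_id s (1 : R)).
    by move/is_derive_eq; apply; rewrite /=; ring.
  have := @is_derive_comp_line R R expR _ s 1 _ _ (is_derive_expR _) dA.
  by move/is_derive_eq; apply; ring.
have dK (a s : R) : is_derive s 1 (fun s => a * expR (- (A * s))) (- (a * A) * expR (- (A * s))).
  have := is_derive_mulf (is_derive_cst a s (1 : R)) (dE s).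
  by move/is_derive_eq; apply; rewrite /=; ring.
move=> s s0; split.
- have := is_derive_addf (is_derive_cst b s (1 : R)) (dK k s).
  by move/is_derive_eq; apply; rewrite add0r.
- by have := dK (- (k * A)) s; move/is_derive_eq; apply; ring.
- apply/differentiable_continuous/derivable1_diffP.
  exact: is_derive_derivable (dK _ s).
Qed.

Lemma exp_profile_slope_neq0 s : k != 0 -> A != 0 ->
  - (k * A) * expR (- (A * s)) != 0.
Proof. by move=> k0 A0; rewrite mulf_neq0 ?oppr_eq0 ?mulf_neq0// gt_eqF// expR_gt0. Qed.

Lemma enorm_grad_exp (N m : nat) (c x : 'rV[R]_N) : 0 <= A ->
  enorm (grad (radial m c exp_profile) x) =
    2 * m%:R * `|k| * A * enorm (x - c) ^+ (2 * m.-1).+1 *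
    expR (- (A * enorm (x - c) ^+ (2 * m))).
Proof.
move=> A0; rewrite (enorm_grad_radial (C2_profile_at m c x C2_profile_exp)).
rewrite normrM normrN normrM (ger0_norm (expR_ge0 _)) (ger0_norm A0).
by rewrite sqdistE -exprM; ring.
Qed.

Lemma p_laplacian_exp (N m : nat) (c x : 'rV[R]_N) (p : R) :
  (1 < m)%N -> x != c -> k != 0 -> 0 < A ->
  p_laplacian p (radial m c exp_profile) x =
    Num.sg k *
    (enorm (grad (radial m c exp_profile) x) `^ (p - 1) / enorm (x - c)) *
    (2 * (p - 1) * m%:R * (A * enorm (x - c) ^+ (2 * m))
     - (N%:R + p - 2 + 2 * (p - 1) * (m%:R - 1))).
Proof.
move=> m1 xc k0 A0.
have n0 s := exp_profile_slope_neq0 s k0 (lt0r_neq0 A0).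
rewrite (p_laplacian_radial_sg p m1 xc C2_profile_exp (n0 _)).
rewrite sgrM sgrN sgrM (gtr0_sg A0) (gtr0_sg (expR_gt0 _)) sqdistE -exprM.
have E0 := expR_gt0 (- (A * enorm (x - c) ^+ (2 * m))).
by field; rewrite k0 !gt_eqF// enorm_gt0 subr_eq0.
Qed.

End exponential_profile.

(** * Upper bounds that propagate from the initial values *)

Section euclidean_balls.
Context {R : realType} {N : nat} (c : 'rV[R]_N).

Lemma compact_annulus (a b : R) : compact [set x | a <= sqdist c x <= b].
Proof.
apply: (@compact_preimage_sqdist _ _ c [set r | a <= r <= b] b); last first.
  by move=> r /= /andP[].
rewrite (_ : [set r | a <= r <= b] = `[a, b]%classic); first exact: interval_closed.
by apply/seteqP; split => r /=; rewrite in_itv.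
Qed.

Lemma open_annulus (a b : R) : open [set x | a < sqdist c x < b].
Proof.
rewrite (_ : [set x | _] = sqdist c @^-1` `]a, b[%classic).
  apply: open_comp; last exact: interval_open.
  by move=> x _; exact: continuous_sqdist.
by apply/seteqP; split => r /=; rewrite in_itv.
Qed.

End euclidean_balls.

Section solution_estimates.
Context {R : realType} {N : nat} (p q : R) (u : R * 'rV[R]_N -> R) (m : nat) (M : R).
Hypotheses (p1 : 1 < p) (p2 : p < 2).
Hypothesis m1 : (1 < m)%N.
Hypothesis mp : 1 < (2 * m%:R - 1) * (p - 1).
Hypothesis cu : {within [set z : R * 'rV[R]_N | 0 <= z.1], continuous u}.
Hypothesis sub : viscosity_subsolution p q u.
Hypotheses (M0 : 0 < M) (uM : forall t x, 0 <= t -> u (t, x) <= M).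

Let m0 : 0 < m%:R :> R. Proof. by rewrite ltr0n (ltn_trans _ m1). Qed.

Lemma expR_N1_le : expR (- 1) <= 1 / 2 :> R.
Proof.
rewrite expRN div1r lef_pV2 ?posrE ?expR_gt0//.
by have := @expR_ge1Dx R 1; lra.
Qed.

(** The barrier equals [d] at the centre of the ball and exceeds the global bound
[M] on its boundary.  Stretching it over a ball of radius [rho] makes its
p-Laplacian of order 1 / rho at most, so the boundary hardly matters for large
[rho]. *)
Lemma localized_upper_bound : exists2 C : R, 0 <= C & forall rho t1 d (x0 : 'rV[R]_N),
  1 <= rho -> 0 <= t1 -> 0 <= d ->
  (forall x, enorm (x - x0) <= rho -> u (t1, x) <= d) ->
  forall t, t1 <= t -> u (t, x0) <= d + C / rho * (t - t1).
Proof.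
(* As exp(-1) <= 1 / 2, the value [d + B (1 - exp(-1))] on the boundary is at
   least [M]. *)
pose B := 2 * M; have B0 : 0 < B by rewrite /B mulr_gt0.
pose kap : R := N%:R + 2 * m%:R.
have kap0 : 0 <= kap by rewrite addr_ge0// mulr_ge0.
pose K := (2 * m%:R * B) `^ (p - 1).
have K0 : 0 <= K by exact: powR_ge0.
exists (K * kap); first exact: mulr_ge0.
move=> rho t1 d x0 rho1 t10 d0 hd t tt1.
have [p1' p2'] := (p1, p2).
have rho0 : 0 < rho by lra.
pose A := rho ^- (2 * m).
have A0 : 0 < A by rewrite invr_gt0 exprn_gt0.
pose F := exp_profile (d + B) (- B) A.
have nB0 : - B != 0 by rewrite oppr_eq0 gt_eqF.
have hF := C2_profile_exp (d + B) (- B) A.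
have F1n0 s : 0 <= s -> - (- B * A) * expR (- (A * s)) != 0.
  by move=> _; apply: exp_profile_slope_neq0 => //; rewrite gt_eqF.
pose Do := [set x | - 1 < sqdist x0 x < rho ^+ 2].
pose D := [set x | - 1 <= sqdist x0 x <= rho ^+ 2].
have l0 : 0 <= K * kap / rho by rewrite divr_ge0 ?mulr_ge0// ltW.
have Fd x : d <= radial m x0 F x.
  rewrite /radial /F /exp_profile mulNr -addrA lerDl subr_ge0 ger_pMr//.
  rewrite -[leRHS]expR0 ler_expR oppr_le0 mulr_ge0 ?(ltW A0)//.
  by rewrite exprn_ge0// sqdist_ge0.
have Fx0 : radial m x0 F x0 = d.
  rewrite /radial /F /exp_profile sqdistE subrr enorm0 expr0n/= expr0n.
  by rewrite -[m == 0]negbK -lt0n (ltn_trans _ m1)//= mulr0 oppr0 expR0; ring.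
rewrite -Fx0.
apply: (@subsolution_comparison _ _ p q u m x0 m1 mp cu F _ _ hF F1n0 D Do t1 (t + 1) _ _ _ _ _ sub).
- exact: compact_annulus.
- exact: open_annulus.
- by move=> x /= /andP[h1 h2]; apply/andP; split; exact: ltW.
- exact: t10.
- move=> x /= /andP[_ xr] xx0; rewrite (p_laplacian_exp _ _ m1 xx0 nB0 A0).
  rewrite (enorm_grad_exp _ _ _ _ _ (ltW A0)).
  set r := enorm (x - x0); have r0 : 0 < r by rewrite enorm_gt0 subr_eq0.
  have rrho : r < rho by move: xr; rewrite sqdistE ltr_pXn2r// nnegrE ltW.
  rewrite sgrN gtr0_sg// normrN (gtr0_norm B0).
  set E := expR _; have E0 : 0 < E by exact: expR_gt0.
  have E1 : E <= 1.
    by rewrite -[leRHS]expR0 ler_expR oppr_le0 mulr_ge0 ?(ltW A0)// exprn_ge0// ?ltW.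
  set g := _ * E; have g0 : 0 <= g.
    by rewrite /g !mulr_ge0 ?(ltW E0) ?(ltW B0) ?(ltW A0) ?exprn_ge0// ?ltW.
  pose y := r / rho; have y0 : 0 < y by rewrite divr_gt0.
  have y1 : y <= 1 by rewrite ler_pdivrMr// mul1r ltW.
  set n := (2 * m.-1).+1 in g g0 *.
  have nE : (2 * m = n.+1)%N by rewrite /n; case: (m) m1 => // k _; rewrite /= mulnS.
  have B'0 : 0 <= 2 * m%:R * B by rewrite !mulr_ge0// ltW.
  have yn0 : 0 <= y ^+ n by exact: exprn_ge0 (ltW y0).
  have gy : g <= 2 * m%:R * B * y ^+ n.
    have -> : g = 2 * m%:R * B * y ^+ n * (E / rho).
      rewrite /g /A nE /y expr_div_n exprS; field.
      by rewrite expf_neq0 ?gt_eqF.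
    apply: ler_piMr; last by rewrite ler_pdivrMr// mul1r; lra.
    exact: mulr_ge0.
  (* Here the flatness of the barrier absorbs the singularity of 1 / r. *)
  have gp : g `^ (p - 1) <= K * y.
    apply: (@le_trans _ _ ((2 * m%:R * B * y ^+ n) `^ (p - 1))).
      apply: ge0_ler_powR => //; rewrite ?nnegrE//; first by rewrite subr_ge0 ltW.
      exact: mulr_ge0.
    rewrite powRM// -/K.
    rewrite ler_wpM2l// -powR_mulrn ?(ltW y0)// -powRrM.
    apply: ge1r_powR; first by rewrite y0 y1.
    have -> : n%:R = 2 * m%:R - 1 :> R.
      by rewrite -natrM nE -natr1; ring.
    exact: ltW.
  have gr : 0 <= g `^ (p - 1) / r <= K / rho.
    rewrite divr_ge0 ?powR_ge0 ?(ltW r0)//= ler_pdivrMr//.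
    by apply: (le_trans gp); rewrite /y mulrA mulrAC.
  have Gq : 0 <= g `^ q by exact: powR_ge0.
  set W := A * _; have W0 : 0 <= W.
    by rewrite /W mulr_ge0 ?(ltW A0)// exprn_ge0// ?ltW.
  set G := g `^ (p - 1) / r in gr *.
  have pm : (p - 1) * m%:R <= m%:R by rewrite ler_piMl ?ltW//; lra.
  have pW : 0 <= 2 * (p - 1) * m%:R * W.
    by apply: mulr_ge0 => //; apply: mulr_ge0 => //; apply: mulr_ge0 => //; lra.
  have h : G * (N%:R + p - 2 + 2 * (p - 1) * (m%:R - 1) - 2 * (p - 1) * m%:R * W) <= K / rho * kap.
    apply: (@le_trans _ _ (G * kap)); first by rewrite ler_wpM2l ?(andP gr).1// /kap; nra.
    by rewrite ler_wpM2r// (andP gr).2.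
  have -> : K * kap / rho = K / rho * kap by ring.
  by lra.
- by move=> _.
- move=> x /= /andP[_ xr]; apply: le_trans (Fd x); apply: hd.
  by move: xr; rewrite sqdistE ler_pXn2r// nnegrE ?enorm_ge0// ltW.
- move=> s x /andP[s1 s2] /= /andP[_ xr] nDo.
  have xE : sqdist x0 x = rho ^+ 2.
    apply/eqP; rewrite eq_le xr/= leNgt; apply/negP => xlt; apply: nDo => /=.
    by apply/andP; split => //; apply: lt_le_trans (sqdist_ge0 x0 x); lra.
  have : u (s, x) <= M by apply: uM; lra.
  have : M <= radial m x0 F x.
    rewrite /radial xE -exprM /F /exp_profile /A mulVf ?expf_neq0 ?gt_eqF//.
    by have := expR_N1_le; have := M0; rewrite /B; nra.
  have : 0 <= K * kap / rho * (s - t1) by rewrite mulr_ge0// subr_ge0.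
  by lra.
- by rewrite tt1; lra.
- by rewrite /D /= sqdistE subrr enorm0 expr0n/= sqr_ge0 lerN10.
Qed.

(** Let the radius tend to infinity in [localized_upper_bound]. *)
Lemma zero_persists t1 : 0 <= t1 -> (forall x, u (t1, x) <= 0) ->
  forall t x, t1 <= t -> u (t, x) <= 0.
Proof.
move=> t10 h1 t x tt1; have [C C0 hC] := localized_upper_bound.
rewrite leNgt; apply/negP => ut.
pose a := C * (t - t1) / u (t, x).
have a0 : 0 <= a by rewrite divr_ge0 ?(ltW ut)// mulr_ge0// subr_ge0.
have r0 : 0 < 1 + a by lra.
have := hC (1 + a) t1 0 x _ t10 (lexx _) (fun y _ => h1 y) t tt1.
rewrite lerDl a0 => /(_ isT); rewrite add0r mulrAC ler_pdivlMr//.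
rewrite mulrDr mulr1 /a mulrC mulfVK ?gt_eqF//; lra.
Qed.

(** Far away, balls of large radius [rho] only meet points where the initial value
is at most [eta / 2]. *)
Lemma vanishes_at_infinity (u0 : 'rV[R]_N -> R) (C0 gam : R) : (0 < N)%N ->
  0 < C0 -> 0 < gam -> (forall x, u (0, x) = u0 x) ->
  (forall x, x != 0 -> u0 x <= C0 * enorm x `^ (- gam)) ->
  forall T eta, 0 <= T -> 0 < eta -> exists2 r1, 0 < r1 &
    forall t x, 0 <= t <= T -> r1 <= enorm x -> u (t, x) <= eta.
Proof.
move=> N0 C00 gam0 u_0 hu0 T eta T0 eta0.
have [C Cge0 hC] := localized_upper_bound.
pose rho := 1 + C * T / (eta / 2).
have rho1 : 1 <= rho.
  by rewrite /rho lerDl; apply: divr_ge0; [exact: mulr_ge0|rewrite divr_ge0// ltW].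
pose rd := (2 * C0 / eta) `^ (gam^-1).
have rd0 : 0 < rd by rewrite powR_gt0// divr_gt0// mulr_gt0.
have hrd : C0 * rd `^ (- gam) = eta / 2.
  rewrite powRN /rd -powRrM mulVf ?gt_eqF// powRr1; last first.
    by apply: divr_ge0; [apply: mulr_ge0 => //; exact: ltW|exact: ltW].
  by field; rewrite !gt_eqF.
have N0' : 0 < N%:R :> R by rewrite ltr0n.
exists (N%:R * (rho + rd)); first by rewrite mulr_gt0//; lra.
move=> t x /andP[t0 tT] hx.
have nx : rho + rd <= `|x|.
  by rewrite -(ler_pM2l N0') (le_trans hx)// ler_enorm_norm.
apply: (@le_trans _ _ (eta / 2 + C / rho * (t - 0))).
  apply: hC => //; first by rewrite divr_ge0// ltW.
  move=> y yx; rewrite u_0.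
  have ny : rd <= enorm y.
    apply: le_trans (ler_norm_enorm y).
    have := ler_norm_enorm (y - x); have := ler_normD y (x - y).
    by rewrite addrC subrK distrC; lra.
  have y0 : 0 < enorm y by lra.
  apply: (le_trans (hu0 y _)); first by rewrite -enorm_gt0.
  rewrite -hrd ler_pM2l// !powRN lef_pV2 ?posrE; last 2 first.
  - exact: powR_gt0.
  - exact: powR_gt0.
  by apply: ge0_ler_powR; rewrite ?nnegrE// ltW.
rewrite [X in _ <= X]splitr lerD2l subr0.
have rho0 : 0 < rho by lra.
rewrite mulrAC ler_pdivrMr// /rho mulrDr mulr1 [eta / 2 * _]mulrC mulfVK; last first.
  by rewrite gt_eqF// divr_gt0.
have : C * t <= C * T by rewrite ler_wpM2l.
lra.
Qed.

End solution_estimates.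

(** * A stationary bound *)

Section power_profile.
Context {R : realType} (b K nu : R).

Definition power_profile (s : R) : R := b + K * (1 + s) `^ (- nu).

Lemma C2_profile_power : C2_profile power_profile
  (fun s => - (K * nu) * (1 + s) `^ (- nu - 1))
  (fun s => K * nu * (nu + 1) * (1 + s) `^ (- nu - 2)).
Proof.
have dP (a e s : R) : 0 <= s ->
    is_derive s 1 (fun s => a * (1 + s) `^ e) (a * e * (1 + s) `^ (e - 1)).
  move=> s0; have s1 : 0 < 1 + s by lra.
  have d1 := is_derive_addf (is_derive_cst (1 : R) s (1 : R)) (is_derive_id s (1 : R)).
  have := @is_derive_comp_line R R (fun r => r `^ e) _ s 1 _ _ (is_derive1_powR e s1) d1.
  move=> /(is_derive_mulf (is_derive_cst a s (1 : R))).
  by move/is_derive_eq; apply; rewrite /=; ring.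
move=> s s0; split.
- have := is_derive_addf (is_derive_cst b s (1 : R)) (dP K (- nu) s s0).
  by move/is_derive_eq; apply; ring.
- have := dP (- (K * nu)) (- nu - 1) s s0; move/is_derive_eq; apply.
  by rewrite (_ : - nu - 1 - 1 = - nu - 2); ring.
- apply/differentiable_continuous/derivable1_diffP.
  exact: is_derive_derivable (dP _ _ s s0).
Qed.

End power_profile.

Section stationary_bound.
Context {R : realType} {N : nat} (p q Q : R) (u : R * 'rV[R]_N -> R) (m : nat) (M C0 gam : R).
Hypotheses (N0 : (0 < N)%N) (p1 : 1 < p) (p2 : p < 2).
Hypothesis m1 : (1 < m)%N.
Hypothesis mp : 1 < (2 * m%:R - 1) * (p - 1).
Hypothesis cu : {within [set z : R * 'rV[R]_N | 0 <= z.1], continuous u}.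
Hypothesis sub : viscosity_subsolution p q u.
Hypotheses (M0 : 0 < M) (uM : forall t x, 0 <= t -> u (t, x) <= M).
Hypotheses (qQ : q <= Q) (pQ : p - 1 < Q).
Hypotheses (gam0 : 0 < gam) (gamE : (gam + 1) * (Q - p + 1) = 1).
Hypotheses (C00 : 0 < C0)
  (u0_decay : forall x, x != 0 -> u (0, x) <= C0 * enorm x `^ (- gam)).

Lemma powR_add1_bounds (s e : R) : 1 <= s -> 0 <= e ->
  2 `^ (- e) * s `^ (- e) <= (1 + s) `^ (- e) <= s `^ (- e).
Proof.
move=> s1 e0; have s0 : 0 < s by lra.
have le (x y : R) : 0 < x -> x <= y -> y `^ (- e) <= x `^ (- e).
  move=> x0 xy; rewrite !powRN lef_pV2 ?posrE ?powR_gt0//; last lra.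
  by apply: ge0_ler_powR; rewrite ?nnegrE//; lra.
rewrite -powRM; [|lra|lra].
by apply/andP; split; apply: le; lra.
Qed.

(** By [gamE], both |grad|^(p-1) / r and |grad|^Q are multiples of the same power
of r for K r^-gam, with factors K^(p-1) and K^Q; as Q > p - 1, absorption wins
for K large.  The barrier K (1 + r^(2m))^-nu, with 2 m nu = gam, is comparable to
that power for r >= 1.  With K proportional to M r0^gam it has height about M at
the inner radius [r0], so a large [r0] gives both a large K and a gradient of
order M / r0 <= 1.  The latter makes |grad|^q at least |grad|^Q. *)
Lemma stationary_upper_bound : exists K r0 : R,
  [/\ 0 < K, 0 < r0, M <= K * r0 `^ (- gam) &
      forall t x, 0 <= t -> r0 <= enorm x -> u (t, x) <= K * enorm x `^ (- gam)].
Proof.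
have [p1' p2'] := (p1, p2); have [M0' pQ'] := (M0, pQ).
have gam0' := gam0; have m0 : 0 < m%:R :> R by rewrite ltr0n (ltn_trans _ m1).
have N1 : 1 <= N%:R :> R by rewrite ler1n.
have [nu [nu0 nuE]] : exists nu : R, 0 < nu /\ 2 * m%:R * nu = gam.
  by exists (gam / (2 * m%:R)); split; [rewrite divr_gt0// mulr_gt0|field; rewrite gt_eqF].
pose C1 := gam + 2 * m%:R; have C10 : 0 < C1 by rewrite addr_gt0// mulr_gt0.
have bracket (z : R) : 0 <= z <= 1 -> 2 * (p - 1) * m%:R * ((nu + 1) * z)
    - (N%:R + p - 2 + 2 * (p - 1) * (m%:R - 1)) <= C1.
  move=> /andP[z0 z1].
  have m1' : 1 <= m%:R :> R by rewrite ler1n (ltn_trans _ m1).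
  have h1 : 0 <= (p - 1) * (m%:R - 1) by rewrite mulr_ge0//; lra.
  have h2 : 2 * (p - 1) * m%:R * ((nu + 1) * z) <= C1.
    rewrite /C1 -nuE.
    have -> : 2 * m%:R * nu + 2 * m%:R = 1 * (2 * m%:R * ((nu + 1) * 1)) by ring.
    have -> : 2 * (p - 1) * m%:R * ((nu + 1) * z) =
      (p - 1) * (2 * m%:R * ((nu + 1) * z)) by ring.
    apply: ler_pM; [lra| |lra|].
      by apply: mulr_ge0; [rewrite mulr_ge0// ltW|rewrite mulr_ge0//; lra].
    by rewrite ler_pM2l ?mulr_gt0// ler_pM2l//; lra.
  by lra.
pose w := Q - p + 1; have w0 : 0 < w by rewrite /w; lra.
have gw : (gam + 1) * w = 1 by exact: gamE.
pose y3 := C0 / M; pose y4 := 2 / (M * gam) * C1 `^ w^-1.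
have y30 : 0 < y3 by rewrite divr_gt0.
have y40 : 0 < y4 by rewrite mulr_gt0 ?powR_gt0// divr_gt0// mulr_gt0.
(* The last three lower bounds on [r0] ensure, in this order, that the gradient is
   at most 1, that the initial datum lies below the barrier, and that absorption wins. *)
have [r0 [r01 r0M r0y3 r0y4]] : exists r0 : R, [/\ 1 <= r0, M * 2 `^ nu * gam <= r0,
    y3 <= r0 `^ gam & y4 <= r0 `^ gam].
  have ga0 : 0 <= M * 2 `^ nu * gam.
    by apply: mulr_ge0; [apply: mulr_ge0; [exact: ltW|exact: powR_ge0]|exact: ltW].
  have sum4 (x1 x2 x3 : R) : 0 <= x1 -> 0 <= x2 -> 0 <= x3 ->
      [/\ 1 <= 1 + x1 + x2 + x3, x1 <= 1 + x1 + x2 + x3,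
          x2 <= 1 + x1 + x2 + x3 & x3 <= 1 + x1 + x2 + x3].
    by move=> *; split; lra.
  have inv (y : R) : 0 < y -> y = (y `^ gam^-1) `^ gam.
    by move=> yp; rewrite -powRrM mulVf ?gt_eqF// powRr1 ?ltW.
  have [] := sum4 _ _ _ ga0 (powR_ge0 y3 gam^-1) (powR_ge0 y4 gam^-1).
  move: (1 + _ + _ + _) => r0 r01 r0M h3 h4; exists r0; split => //.
    rewrite (inv _ y30); apply: ge0_ler_powR; rewrite ?nnegrE ?powR_ge0 ?(ltW gam0)//.
    exact: le_trans r01.
  rewrite (inv _ y40); apply: ge0_ler_powR; rewrite ?nnegrE ?powR_ge0 ?(ltW gam0)//.
  exact: le_trans r01.
have r00 : 0 < r0 by exact: lt_le_trans r01.
have [K [K0 K2 Kr0 KE]] : exists K : R, [/\ 0 < K, K * 2 `^ (- nu) = M * r0 `^ gam,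
    K * r0 `^ (- gam) = M * 2 `^ nu & K = M * 2 `^ nu * r0 `^ gam].
  exists (M * 2 `^ nu * r0 `^ gam); split => //.
  - by rewrite !mulr_gt0 ?powR_gt0.
  - by rewrite powRN mulrAC mulfK// gt_eqF// powR_gt0.
  - by rewrite powRN mulfK// gt_eqF// powR_gt0.
have KC0 : C0 <= K * 2 `^ (- nu) by rewrite K2 mulrC -ler_pdivrMr.
exists K, r0; split => //.
  rewrite Kr0 ler_pMr// -[leLHS](powRr0 2); apply: ler_powR; lra.
(* Adding [eta] to the barrier takes care of the outer sphere. *)
move=> t x t0 xr; apply/ler_addgt0Pr => eta eta0.
have T0 : 0 <= t + 1 by lra.
have [r1 r10 hr1] := @vanishes_at_infinity R N p q u m M p1 p2 m1 mp cu sub M0 uM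
  (fun x => u (0, x)) C0 gam N0 C00 gam0 (fun=> erefl) u0_decay (t + 1) eta T0 eta0.
pose F := power_profile eta K nu.
have hF := C2_profile_power eta K nu.
have F1n0 s : 0 <= s -> - (K * nu) * (1 + s) `^ (- nu - 1) != 0.
  move=> s0; apply: mulf_neq0; first by rewrite oppr_eq0 gt_eqF// mulr_gt0.
  by rewrite gt_eqF// powR_gt0//; lra.
pose R1 := Num.max (enorm x) r1.
have R1x : enorm x <= R1 by rewrite le_max lexx.
have R1r : r1 <= R1 by rewrite le_max lexx orbT.
have R10 : 0 <= R1 by exact: le_trans (enorm_ge0 x) R1x.
pose D := [set y : 'rV[R]_N | r0 ^+ 2 <= sqdist 0 y <= R1 ^+ 2].
pose Do := [set y : 'rV[R]_N | r0 ^+ 2 < sqdist 0 y < R1 ^+ 2].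
have Dr y : D y -> r0 <= enorm y <= R1.
  by rewrite /D /= sqdistE subr0 !ler_pXn2r// nnegrE ?enorm_ge0// ltW.
have powE (r : R) : 1 <= r ->
    2 `^ (- nu) * r `^ (- gam) <= (1 + r ^+ (2 * m)) `^ (- nu) <= r `^ (- gam).
  move=> r_ge1; have r_ge0 : 0 <= r by lra.
  have -> : r `^ (- gam) = (r ^+ (2 * m)) `^ (- nu).
    by rewrite -powR_mulrn// -powRrM natrM mulrN nuE.
  by apply: powR_add1_bounds; [exact: exprn_ege1|exact: ltW].
have radE y : radial m 0 F y = eta + K * (1 + enorm y ^+ (2 * m)) `^ (- nu).
  by rewrite /radial /F /power_profile sqdistE subr0 exprM.
have main : u (t, x) <= radial m 0 F x + 0 * (t - 0).
  apply: (@subsolution_comparison _ _ p q u m 0 m1 mp cu F _ _ hF F1n0 D Do 0 (t + 1) _ _ _ _ _ sub).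
  - exact: compact_annulus.
  - exact: open_annulus.
  - by move=> y /= /andP[h1 h2]; apply/andP; split; exact: ltW.
  - by [].
  - move=> y /= /andP[yr _] yn0.
    have r_gt : r0 < enorm y by move: yr; rewrite sqdistE subr0 ltr_pXn2r// nnegrE ?enorm_ge0// ltW.
    rewrite (p_laplacian_radial_sg p m1 yn0 hF (F1n0 _ (exprn_ge0 _ (sqdist_ge0 _ _)))).
    have gE := enorm_grad_radial (C2_profile_at m 0 y hF).
    rewrite sqdistE subr0 -exprM in gE *; set r := enorm y in r_gt gE *.
    have r_ge1 : 1 <= r by exact: le_trans (ltW r_gt).
    have r_gt0 : 0 < r by exact: lt_trans r_gt.
    set s := r ^+ (2 * m) in gE *.
    have s1 : 1 <= s by exact: exprn_ege1.
    set g := enorm (grad _ _) in gE *.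
    have s10 : 0 < 1 + s by apply: addr_gt0 => //; exact: lt_le_trans s1.
    set E := (1 + s) `^ (- nu - 1) in gE *; have E0 : 0 < E by exact: powR_gt0.
    set n := (2 * m.-1).+1 in gE; have nE : (2 * m = n.+1)%N.
      by rewrite /n; case: (m) m1 => // k _; rewrite /= mulnS.
    have {}gE : g = K * gam * (r ^+ n * E).
      rewrite gE normrM normrN (gtr0_norm E0) gtr0_norm ?mulr_gt0// -nuE; ring.
    have rnE : r ^+ n * s `^ (- nu - 1) = r `^ (- (gam + 1)).
      have -> : s `^ (- nu - 1) = r `^ ((2 * m)%:R * (- nu - 1)).
        by rewrite /s -powR_mulrn ?ltW// -powRrM.
      rewrite -powR_mulrn ?ltW// -powRD; last first.
        by rewrite (gt_eqF r_gt0) implybT.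
      congr (_ `^ _); have := f_equal (fun k => k%:R : R) nE.
      rewrite natrM -natr1 => h.
      by rewrite (_ : n%:R = 2 * m%:R - 1) ?natrM -?nuE; [ring|rewrite h; ring].
    have nu10 : 0 <= nu + 1 by apply: addr_ge0 => //; exact: ltW.
    have /andP[Elo Ehi] := powR_add1_bounds s1 nu10.
    rewrite opprD -/E in Elo Ehi.
    have rn0 : 0 < r ^+ n by exact: exprn_gt0.
    have ghi : g <= K * gam * r `^ (- (gam + 1)).
      by rewrite gE -rnE ler_pM2l ?mulr_gt0// ler_pM2l.
    have glo : M * gam / 2 * r0 `^ gam * r `^ (- (gam + 1)) <= g.
      rewrite gE -rnE.
      have -> : M * gam / 2 * r0 `^ gam * (r ^+ n * s `^ (- nu - 1))
         = K * gam * (r ^+ n * (2 `^ (- nu - 1) * s `^ (- nu - 1))).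
        rewrite (_ : 2 `^ (- nu - 1) = 2 `^ (- nu) / 2); last first.
          by rewrite powRB ?pnatr_eq0 ?implybT// powRr1.
        have := K2; set a := 2 `^ (- nu); set c := r0 `^ gam => h.
        have -> : K * gam * (r ^+ n * (a / 2 * s `^ (- nu - 1)))
          = (K * a) * (gam / 2 * (r ^+ n * s `^ (- nu - 1))) by ring.
        by rewrite h; ring.
      by rewrite ler_pM2l ?mulr_gt0// ler_pM2l.
    have g0 : 0 < g by rewrite gE !mulr_gt0.
    have g1 : g <= 1.
      apply: (le_trans ghi).
      have -> : K * gam * r `^ (- (gam + 1)) = M * 2 `^ nu * gam / r * (r0 `^ gam / r `^ gam).
        rewrite KE powRN powRD ?(gt_eqF r_gt0) ?implybT// powRr1 ?ltW//; field.
        by rewrite !gt_eqF// powR_gt0.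
      have h1 : r0 `^ gam / r `^ gam <= 1.
        rewrite ler_pdivrMr ?powR_gt0// mul1r.
        by apply: ge0_ler_powR; rewrite ?nnegrE// ltW.
      have h2 : M * 2 `^ nu * gam / r <= 1 by rewrite ler_pdivrMr// mul1r (le_trans r0M)// ltW.
      have h3 : 0 <= M * 2 `^ nu * gam / r.
        by rewrite divr_ge0 ?(ltW r_gt0)// !mulr_ge0 ?powR_ge0 ?(ltW gam0) ?(ltW M0).
      have h4 : 0 <= r0 `^ gam / r `^ gam by rewrite divr_ge0// powR_ge0.
      by rewrite -[leRHS]mulr1; apply: ler_pM.
    have Mg2 : 0 < M * gam / 2 by apply: divr_gt0 => //; exact: mulr_gt0.
    have absorb : C1 / r <= g `^ w.
      apply: (@le_trans _ _ ((y4 * (M * gam / 2) * r `^ (- (gam + 1))) `^ w)); last first.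
        apply: ge0_ler_powR; rewrite ?nnegrE ?(ltW w0) ?(ltW g0)//.
          apply: mulr_ge0; last exact: powR_ge0.
          by apply: mulr_ge0; [exact: ltW|exact: ltW Mg2].
        apply: le_trans glo; rewrite ler_pM2r ?powR_gt0//.
        by rewrite mulrC ler_pM2l.
      have -> : y4 * (M * gam / 2) = C1 `^ w^-1.
        by rewrite /y4; field; rewrite !gt_eqF.
      rewrite powRM ?powR_ge0// -!powRrM mulNr gw mulVf ?gt_eqF// powRr1 ?(ltW C10)//.
      by rewrite powR_inv1 ?(ltW r_gt0).
    have gq : g `^ (p - 1) * g `^ w <= g `^ q.
      rewrite -powRD; last by rewrite (gt_eqF g0) implybT.
      rewrite /w (_ : p - 1 + (Q - p + 1) = Q); last by ring.
      by apply: ger_powR => //; rewrite g0.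
    have F1lt0 : - (K * nu) * E < 0 by rewrite mulNr oppr_lt0 !mulr_gt0.
    rewrite (ltr0_sg F1lt0).
    have gp0 : 0 <= g `^ (p - 1) / r by rewrite divr_ge0 ?powR_ge0// ltW.
    have ratio : s * (K * nu * (nu + 1) * (1 + s) `^ (- nu - 2)) / (- (K * nu) * E)
       = - ((nu + 1) * (s / (1 + s))).
      have -> : (1 + s) `^ (- nu - 2) = E / (1 + s).
        rewrite /E (_ : - nu - 2 = (- nu - 1) - 1); last by ring.
        by rewrite [LHS]powRB ?(gt_eqF s10) ?implybT// powRr1 ?ltW.
      by field; rewrite !gt_eqF.
    rewrite ratio.
    have ss : 0 <= s / (1 + s) <= 1.
      have s_ge0 : 0 <= s by exact: le_trans s1.
      by rewrite divr_ge0 ?(ltW s10)//= ler_pdivrMr// mul1r lerDr.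
    have fin : g `^ (p - 1) / r * C1 <= g `^ q.
      apply: le_trans gq; rewrite mulrAC -mulrA ler_wpM2l ?powR_ge0//.
    rewrite subr_le0; apply: le_trans fin.
    have := ler_wpM2l gp0 (bracket _ ss); apply: le_trans.
    by rewrite le_eqVlt; apply/orP; left; apply/eqP; ring.
  - by [].
  - move=> y /Dr /andP[yr _]; have y_ge1 : 1 <= enorm y by exact: le_trans yr.
    rewrite radE; apply: (le_trans (u0_decay _)).
      by rewrite -enorm_gt0 (lt_le_trans ltr01).
    have /andP[h1 _] := powE _ y_ge1.
    apply: ler_wpDl; first exact: ltW.
    apply: (@le_trans _ _ (K * (2 `^ (- nu) * enorm y `^ (- gam)))).
      by rewrite mulrA ler_wpM2r ?powR_ge0.
    by rewrite ler_pM2l.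
  - move=> s y /andP[s0 st] Dy nDo; have /andP[yr yR] := Dr _ Dy.
    rewrite radE mul0r addr0.
    have [yR1|yR1] := leP R1 (enorm y).
      apply: (@le_trans _ _ eta).
        by apply: hr1; [rewrite s0 st|exact: le_trans yR1].
      by rewrite lerDl; apply: mulr_ge0; [exact: ltW|exact: powR_ge0].
    have ry : enorm y = r0.
      apply/eqP; rewrite eq_le yr andbT leNgt; apply/negP => ry; apply: nDo.
      by rewrite /Do /= sqdistE subr0 !ltr_pXn2r ?nnegrE ?enorm_ge0 ?(ltW r00)// ry.
    rewrite ry; have /andP[h1 _] := powE _ r01.
    apply: (le_trans (uM y s0)); apply: ler_wpDl; first exact: ltW.
    apply: (@le_trans _ _ (K * (2 `^ (- nu) * r0 `^ (- gam)))); last by rewrite ler_pM2l.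
    by rewrite mulrA K2 powRN mulfK// gt_eqF// powR_gt0.
  - by rewrite t0 /= lerDl ler01.
  - by rewrite /D /= sqdistE subr0 !ler_pXn2r ?nnegrE ?enorm_ge0 ?(ltW r00)// xr R1x.
apply: (le_trans main); rewrite radE mul0r addr0 addrC lerD2r ler_pM2l//.
by have /andP[] := powE (enorm x) (le_trans r01 xr).
Qed.

End stationary_bound.

(** * Extinction in finite time *)

Lemma time_continuity (R : realType) (N : nat) (u : R * 'rV[R]_N -> R)
  (cu : {within [set z : R * 'rV[R]_N | 0 <= z.1], continuous u}) t0 x : 0 <= t0 -> forall e : R, 0 < e ->
  exists2 d : R, 0 < d & forall t, 0 <= t -> `|t - t0| < d -> `|u (t, x) - u (t0, x)| < e.
Proof.
move=> t00 e e0.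
have /(_ (t0, x) t00) h := (subspace_continuousP _ _).1 cu.
have /cvgrPdist_lt/(_ e e0) := h; rewrite near_withinE => hn.
have c : (s, x) @[s --> t0] --> (t0, x).
  exact: (@cvg_pair _ _ _ (nbhs t0) (nbhs t0) (nbhs x) _ _ _ id (cst x) cvg_id (cvg_cst x)).
have /nbhs_ballP[d /= d0 hd] := c _ hn.
exists d => // t tge td; rewrite distrC; apply: hd => //.
by rewrite /ball/= distrC.
Qed.

Section extinction.
Context {R : realType} {N : nat} (p q : R) (u : R * 'rV[R]_N.+1 -> R) (m : nat).
Hypotheses (p1 : 1 < p) (p2 : p < 2).
Hypothesis m1 : (1 < m)%N.
Hypothesis mp : 1 < (2 * m%:R - 1) * (p - 1).
Hypothesis cu : {within [set z : R * 'rV[R]_N.+1 | 0 <= z.1], continuous u}.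
Hypothesis sub : viscosity_subsolution p q u.

(** The barrier has negative p-Laplacian throughout the ball, because its centre is
placed at distance [2 * rho] from the origin and the profile is steep.  It may
therefore decrease at the constant rate [kap * b `^ (p - 1) * rho `^ (- p)], and
this brings it down from above [H] to [2 * b] in the stated time. *)
Lemma diffusive_drop : exists2 kap : R, 0 < kap & forall rho b H t1 : R,
  0 < rho -> 0 < b -> 0 <= H -> 0 <= t1 ->
  (forall t x, 0 <= t -> rho <= enorm x -> u (t, x) <= b) ->
  (forall x, u (t1, x) <= H) ->
  forall x, u (t1 + H / (kap * b `^ (p - 1) * rho `^ (- p)), x) <= 2 * b.
Proof.
have [p1' p2'] := (p1, p2).
have m0 : 0 < m%:R :> R by rewrite ltr0n (ltn_trans _ m1).
have m1' : 1 <= m%:R :> R by rewrite ler1n (ltn_trans _ m1).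
pose k0 : R := N.+1%:R + p - 2 + 2 * (p - 1) * (m%:R - 1).
have k00 : 0 <= k0.
  have : 1 <= N.+1%:R :> R by rewrite ler1n.
  have : 0 <= (p - 1) * (m%:R - 1) by rewrite mulr_ge0//; lra.
  by rewrite /k0; lra.
have pm0 : 0 < 2 * (p - 1) * m%:R by rewrite !mulr_gt0//; lra.
(* This steepness makes the last factor in [p_laplacian_exp] at least 1. *)
have [A0 A00 A0E] : exists2 A0 : R, 0 < A0 & 2 * (p - 1) * m%:R * A0 = 1 + k0.
  exists ((1 + k0) / (2 * (p - 1) * m%:R)); first by rewrite divr_gt0//; lra.
  by rewrite mulrC divfK// gt_eqF.
(* [b * g0 / rho] is a lower bound of the gradient on the ball. *)
have [g0 g00 g0E] : exists2 g0 : R, 0 < g0 &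
    g0 = 2 * m%:R * A0 * expR (- (A0 * 4 ^+ (2 * m))).
  exists (2 * m%:R * A0 * expR (- (A0 * 4 ^+ (2 * m)))) => //.
  by rewrite mulr_gt0 ?expR_gt0// mulr_gt0// mulr_gt0.
exists (g0 `^ (p - 1) / 4); first by rewrite divr_gt0// powR_gt0.
set kap := g0 `^ (p - 1) / 4; have kap0 : 0 < kap by rewrite divr_gt0// powR_gt0.
move=> rho b H t1 rho0 b0 H0 t10 hout hH x.
have [xr|xr] := leP rho (enorm x).
  apply: (@le_trans _ _ b); last by lra.
  by apply: hout => //; rewrite addr_ge0// divr_ge0// !mulr_ge0 ?powR_ge0// ltW.
set l := kap * b `^ (p - 1) * rho `^ (- p).
have l0 : 0 < l by rewrite /l !mulr_gt0// powR_gt0.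
have tau0 : 0 <= H / l by rewrite divr_ge0// ltW.
pose c : 'rV[R]_N.+1 := (2 * rho) *: delta_mx ord0 ord0.
pose A := A0 / rho ^+ (2 * m).
have rhom : 0 < rho ^+ (2 * m) by exact: exprn_gt0.
have Ap : 0 < A by rewrite divr_gt0.
pose F := exp_profile (2 * b + H) (- b) A.
have nb0 : - b != 0 by rewrite oppr_eq0 gt_eqF.
have hF := C2_profile_exp (2 * b + H) (- b) A.
have F1n0 s : 0 <= s -> - (- b * A) * expR (- (A * s)) != 0.
  by move=> _; apply: exp_profile_slope_neq0 => //; rewrite gt_eqF.
pose Do := [set y : 'rV[R]_N.+1 | - 1 < sqdist 0 y < rho ^+ 2].
pose D := [set y : 'rV[R]_N.+1 | - 1 <= sqdist 0 y <= rho ^+ 2].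
have FbH y : b + H <= radial m c F y <= 2 * b + H.
  rewrite /radial /F /exp_profile.
  set s := sqdist c y ^+ m.
  have s0 : 0 <= s by rewrite exprn_ge0// sqdist_ge0.
  have e1 : expR (- (A * s)) <= 1.
    by rewrite -[leRHS]expR0 ler_expR oppr_le0 mulr_ge0// ltW.
  by have := expR_gt0 (- (A * s)); nra.
have dist y : enorm y <= rho -> rho <= enorm (y - c) <= 4 * rho.
  move=> yr; have yr2 : dotrV y y <= rho ^+ 2.
    by rewrite -sqr_enorm ler_pXn2r// nnegrE ?enorm_ge0// ltW.
  apply/andP; split.
    apply: le_trans (ler_coord_enorm _ ord0); rewrite !mxE/= mulr1 distrC.
    apply: le_trans (ler_norm _).
    have : y ord0 ord0 <= rho by apply: le_trans yr; apply: le_trans (ler_coord_enorm _ ord0); exact: ler_norm.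
    lra.
  rewrite -(@ler_pXn2r _ 2) ?nnegrE ?enorm_ge0 ?mulr_ge0 ?(ltW rho0)//.
  rewrite sqr_enorm.
  have sqB2 (a d : R) : (a - d) * (a - d) <= 2 * (a * a) + 2 * (d * d).
    by have := sqr_ge0 (a + d); rewrite expr2; lra.
  have : dotrV (y - c) (y - c) <= 2 * dotrV y y + 2 * dotrV c c.
    rewrite /dotrV !mulr_sumr -big_split/=; apply: ler_sum => i _; rewrite !mxE.
    exact: sqB2.
  have -> : dotrV c c = 4 * rho ^+ 2.
    by rewrite dotrVZ dotrV_delta mxE !eqxx /=; ring.
  by rewrite exprMn; have := sqr_ge0 rho; lra.
have xD : enorm x <= rho by exact: ltW.
have main : u (t1 + H / l, x) <= radial m c F x + (- l) * (t1 + H / l - t1).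
  apply: (@subsolution_comparison _ _ p q u m c m1 mp cu F _ _ hF F1n0 D Do t1 (t1 + H / l) _ _ _ _ _ sub).
  - exact: compact_annulus.
  - exact: open_annulus.
  - by move=> y /= /andP[h1 h2]; apply/andP; split; exact: ltW.
  - exact: t10.
  - move=> y /= /andP[_ yr] yc; rewrite (p_laplacian_exp _ _ m1 yc nb0 Ap).
    have yr' : enorm y <= rho.
      by move: yr; rewrite sqdistE subr0 => /ltW; rewrite ler_pXn2r// nnegrE ?enorm_ge0// ltW.
    have := enorm_grad_exp (2 * b + H) (- b) m c y (ltW Ap).
    set g := enorm (grad _ _); rewrite normrN (gtr0_norm b0).
    have /andP[r1 r2] := dist _ yr'; set r := enorm (y - c) in r1 r2 *.
    have r0 : 0 < r by lra.
    rewrite sgrN gtr0_sg// -/k0 => gE.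
    have As1 : A0 <= A * r ^+ (2 * m).
      rewrite /A mulrAC ler_pdivlMr// ler_pM2l//.
      by rewrite ler_pXn2r ?nnegrE ?(ltW r0) ?(ltW rho0)// muln_gt0/= (ltn_trans _ m1).
    have As2 : A * r ^+ (2 * m) <= A0 * 4 ^+ (2 * m).
      rewrite /A mulrAC ler_pdivrMr// -mulrA -exprMn ler_pM2l//.
      rewrite ler_pXn2r ?nnegrE ?(ltW r0)//; first by rewrite muln_gt0/= (ltn_trans _ m1).
      by rewrite mulr_ge0// ltW.
    set n := (2 * m.-1).+1 in gE; have nE : (2 * m = n.+1)%N.
      by rewrite /n; case: (m) m1 => // k _; rewrite /= mulnS.
    have glo : b * g0 / rho <= g.
      have -> : b * g0 / rho = 2 * m%:R * b * A * rho ^+ n * expR (- (A0 * 4 ^+ (2 * m))).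
        rewrite g0E /A; move: (expR _) => E; rewrite nE exprS; field.
        by rewrite expf_neq0 ?gt_eqF.
      have cf0 : 0 <= 2 * m%:R * b * A.
        by apply: mulr_ge0; [rewrite !mulr_ge0// ltW|exact: ltW].
      have rhon : 0 <= rho ^+ n by exact: exprn_ge0 (ltW rho0).
      rewrite gE; apply: ler_pM; [exact: mulr_ge0|exact: expR_ge0| |].
        by apply: ler_wpM2l => //; rewrite ler_pXn2r// nnegrE ltW.
      by rewrite ler_expR lerN2.
    have W1 : 1 <= 2 * (p - 1) * m%:R * (A * r ^+ (2 * m)) - k0.
      have : 2 * (p - 1) * m%:R * A0 <= 2 * (p - 1) * m%:R * (A * r ^+ (2 * m)).
        by rewrite ler_pM2l.
      by rewrite A0E; lra.
    have gp : l <= g `^ (p - 1) / r.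
      apply: (@le_trans _ _ ((b * g0 / rho) `^ (p - 1) / (4 * rho))).
        rewrite /l /kap [(b * g0 / rho) `^ _]powRM ?powRM ?invr_ge0 ?mulr_ge0 ?(ltW b0) ?(ltW g00) ?(ltW rho0)//.
        rewrite -(powR_inv1 (ltW rho0)) -powRrM.
        have -> : rho `^ (- p) = rho `^ (- 1 * (p - 1)) / rho.
          rewrite (_ : - p = - 1 * (p - 1) - 1); last by ring.
          by rewrite powRB ?(gt_eqF rho0) ?implybT// powRr1// ltW.
        rewrite le_eqVlt; apply/orP; left; apply/eqP; field.
        by rewrite gt_eqF.
      apply: ler_pM; rewrite ?powR_ge0 ?invr_ge0 ?mulr_ge0 ?(ltW rho0)//.
        apply: ge0_ler_powR; rewrite ?nnegrE//; [lra|by rewrite divr_ge0 ?mulr_ge0// ltW|].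
        by apply: le_trans glo; rewrite divr_ge0 ?mulr_ge0// ltW.
      by rewrite lef_pV2 ?posrE// mulr_gt0.
    have gq : 0 <= g `^ q by exact: powR_ge0.
    set G := g `^ (p - 1) / r in gp *.
    set W := _ - k0 in W1 *.
    have : l * 1 <= G * W by apply: ler_pM => //; exact: ltW.
    lra.
  - move=> cD; exfalso; move: cD; rewrite /Do /= => /andP[_].
    rewrite /sqdist subr0 dotrVZ dotrV_delta mxE !eqxx /=.
    by have := sqr_ge0 rho; rewrite expr2; lra.
  - by move=> y _; have /andP[h _] := FbH y; have := hH y; lra.
  - move=> t y /andP[t1t t2] /= /andP[_ yr] nDo.
    have yE : sqdist 0 y = rho ^+ 2.
      apply/eqP; rewrite eq_le yr/= leNgt; apply/negP => ylt; apply: nDo => /=.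
      by apply/andP; split => //; apply: lt_le_trans (sqdist_ge0 0 y); lra.
    have yr' : rho <= enorm y.
      by move: yE; rewrite sqdistE subr0 => /eqP; rewrite eqrXn2 ?enorm_ge0 ?(ltW rho0)// => /eqP ->.
    have ub : u (t, y) <= b by apply: hout => //; lra.
    have /andP[h _] := FbH y.
    have : l * (t - t1) <= H by rewrite mulrC -ler_pdivlMr//; lra.
    lra.
  - by rewrite lerDl tau0 lexx.
  - rewrite /D /= sqdistE subr0 ler_pXn2r ?nnegrE ?enorm_ge0 ?(ltW rho0)// xD andbT.
    by apply: le_trans (sqr_ge0 _); lra.
apply: (le_trans main); have /andP[_ h] := FbH x.
rewrite (_ : t1 + H / l - t1 = H / l); last by ring.
by rewrite mulNr mulrC divfK ?gt_eqF//; lra.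
Qed.

Hypothesis u_ge0 : forall t x, 0 <= t -> 0 <= u (t, x).

(** With [bn n] the bound outside the ball of radius [2 ^+ n * r0], the solution is
at most [H n = 2 * 2 `^ gam * bn n] at time [tn n]: one application of
[diffusive_drop] gives [2 * bn n], which is [H n.+1].  The durations are
[C * th ^+ n] with [th = 2 `^ (p - gam * (2 - p)) < 1]. *)
Lemma finite_time_extinction (M K r0 gam : R) : 0 < K -> 0 < r0 ->
  p < gam * (2 - p) -> M <= K * r0 `^ (- gam) ->
  (forall t x, 0 <= t -> u (t, x) <= M) ->
  (forall t x, 0 <= t -> r0 <= enorm x -> u (t, x) <= K * enorm x `^ (- gam)) ->
  exists2 T : R, 0 <= T & forall x, u (T, x) = 0.
Proof.
move=> K0 r00 pgam MK uM uK; have [p1' p2'] := (p1, p2).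
have gam0 : 0 < gam.
  by rewrite -(@pmulr_lgt0 _ (2 - p)); lra.
have [kap kap0 drop] := diffusive_drop.
pose a := p - gam * (2 - p); have a0 : a < 0 by rewrite /a; lra.
pose th := 2 `^ a : R; pose ph := 2 `^ (- gam) : R.
have pow2_lt1 (e : R) : 0 < e -> 0 < (2 : R) `^ (- e) < 1.
  move=> e0; rewrite powRN invr_gt0 powR_gt0//= invf_lt1 ?powR_gt0//.
  rewrite -[X in X < _](_ : 1 `^ e = 1); last by rewrite powR1.
  by rewrite gt0_ltr_powR ?nnegrE ?ltr1n.
have /andP[th0 th1] : 0 < th < 1.
  by rewrite /th -(opprK a); apply: pow2_lt1; rewrite oppr_gt0.
have /andP[ph0 ph1] : 0 < ph < 1 by exact: pow2_lt1.
have th1' : 0 < 1 - th by rewrite subr_gt0.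
pose rn n : R := r0 * 2 ^+ n.
have rn0 n : 0 < rn n by rewrite mulr_gt0// exprn_gt0.
have rnS n : rn n.+1 = rn n * 2 by rewrite /rn exprSr mulrA.
pose bn n := K * rn n `^ (- gam).
have bn0 n : 0 < bn n by rewrite mulr_gt0// powR_gt0.
have bnS n : bn n.+1 = bn n * ph.
  by rewrite /bn rnS powRM ?(ltW (rn0 n))// mulrA.
have bnE n : bn n = bn 0 * ph ^+ n.
  by elim: n => [|n IH]; rewrite ?expr0 ?mulr1// bnS IH exprSr mulrA.
pose H n := 2 * 2 `^ gam * bn n.
have g20 : 0 < 2 `^ gam :> R by exact: powR_gt0.
have g2ph : 2 `^ gam * ph = 1 by rewrite /ph powRN mulfV// gt_eqF.
have H0 n : 0 <= H n.
  by apply: mulr_ge0; [apply: mulr_ge0 => //; exact: ltW|exact: ltW (bn0 n)].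
have HS n : H n.+1 = 2 * bn n.
  rewrite /H bnS (_ : _ * (bn n * ph) = 2 * bn n * (2 `^ gam * ph)); last by ring.
  by rewrite g2ph mulr1.
pose C := 2 * 2 `^ gam / kap * K `^ (2 - p) * r0 `^ a.
have C0 : 0 < C by rewrite !mulr_gt0 ?invr_gt0 ?powR_gt0.
have tauE n : H n / (kap * bn n `^ (p - 1) * rn n `^ (- p)) = C * th ^+ n.
  have e1 : bn n = bn n `^ (p - 1) * bn n `^ (2 - p).
    rewrite -powRD; last by rewrite (gt_eqF (bn0 n)) implybT.
    by rewrite (_ : p - 1 + (2 - p) = 1) ?powRr1 ?(ltW (bn0 n))//; ring.
  have e2 : bn n `^ (2 - p) = K `^ (2 - p) * rn n `^ (- (gam * (2 - p))).
    by rewrite /bn powRM ?powR_ge0 ?(ltW K0)// -powRrM mulNr.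
  have e3 : rn n `^ (- (gam * (2 - p))) = r0 `^ a * th ^+ n * rn n `^ (- p).
    have -> : r0 `^ a * th ^+ n = rn n `^ a.
      rewrite /rn powRM ?exprn_ge0 ?(ltW r00)// (_ : (2 ^+ n) `^ a = th ^+ n)//.
      by rewrite -(powR_mulrn n (ler0n _ 2)) -(powR_mulrn n (powR_ge0 2 a)) powRAC.
    rewrite -powRD; last by rewrite (gt_eqF (rn0 n)) implybT.
    by congr (_ `^ _); rewrite /a; ring.
  rewrite /H {1}e1 e2 e3 /C; field.
  by rewrite !gt_eqF ?powR_gt0.
pose tn n := C * (1 - th ^+ n) / (1 - th).
have thn n : 0 < th ^+ n <= 1 by rewrite exprn_gt0//= exprn_ile1// ltW.
have tn0 n : 0 <= tn n.
  rewrite divr_ge0 ?(ltW th1')// mulr_ge0 ?(ltW C0)// subr_ge0.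
  by have /andP[] := thn n.
have tnS n : tn n.+1 = tn n + C * th ^+ n.
  by rewrite /tn exprSr; field; rewrite gt_eqF.
have bound n x : u (tn n, x) <= H n.
  elim: n x => [|n IH] x.
    apply: (le_trans (uM _ _ (tn0 0))); apply: (le_trans MK).
    rewrite /H /bn /rn expr0 mulr1; apply: ler_peMl.
      by rewrite mulr_ge0 ?powR_ge0// ltW.
    have : 1 <= 2 `^ gam :> R by rewrite -[X in X <= _](powRr0 2) ler_powR ?ler1n// ltW.
    by lra.
  rewrite tnS -tauE HS; apply: drop => //.
  move=> t y t0 yr; apply: (le_trans (uK _ _ t0 _)).
    apply: le_trans yr; rewrite /rn ler_peMr ?(ltW r00)//.
    by rewrite exprn_ege1// ler1n.
  rewrite /bn ler_pM2l// !powRN lef_pV2 ?posrE ?powR_gt0//; last exact: lt_le_trans yr.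
  by apply: ge0_ler_powR; rewrite ?nnegrE ?enorm_ge0// ltW.
pose T := C / (1 - th).
have T0 : 0 <= T by rewrite divr_ge0// ltW.
exists T => // x; apply/eqP; rewrite eq_le u_ge0// andbT leNgt; apply/negP => uT.
have e0 : 0 < u (T, x) / 2 by rewrite divr_gt0.
have [d d0 hd] := time_continuity cu x T0 e0.
have cth : T * th ^+ n @[n --> \oo] --> T * 0.
  by apply: cvgM; [exact: cvg_cst|apply: cvg_expr; rewrite ger0_norm// ltW].
have cph : H 0 * ph ^+ n @[n --> \oo] --> H 0 * 0.
  by apply: cvgM; [exact: cvg_cst|apply: cvg_expr; rewrite ger0_norm// ltW].
rewrite mulr0 in cth; rewrite mulr0 in cph.
have /cvgrPdist_lt/(_ d d0) n1 := cth.
have /cvgrPdist_lt/(_ _ e0) n2 := cph.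
have [n [h1 h2]] : exists n, `|0 - T * th ^+ n| < d /\ `|0 - H 0 * ph ^+ n| < u (T, x) / 2.
  have [k _ hk] : \forall n \near \oo,
      `|0 - T * th ^+ n| < d /\ `|0 - H 0 * ph ^+ n| < u (T, x) / 2.
    by apply: filterI.
  by exists k; apply: hk => /=.
have dist : `|tn n - T| < d.
  rewrite (_ : tn n - T = 0 - T * th ^+ n)// /tn /T; field.
  by rewrite gt_eqF.
have := hd _ (tn0 n) dist.
have HE : H n = H 0 * ph ^+ n by rewrite /H bnE mulrA.
have := bound n x; rewrite HE.
move: h2; rewrite !ltr_norml => /andP[h3 h4] h5 /andP[h6 h7].
by lra.
Qed.

End extinction.

(** * Positivity *)

Section positivity.
Context {R : realType} {N : nat} (p q : R) (u : R * 'rV[R]_N -> R) (m : nat).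
Hypotheses (p1 : 1 < p) (p2 : p < 2) (pq : p - 1 <= q).
Hypothesis m1 : (1 < m)%N.
Hypothesis mp : 1 < (2 * m%:R - 1) * (p - 1).
Hypothesis cu : {within [set z : R * 'rV[R]_N | 0 <= z.1], continuous u}.
Hypothesis sup : viscosity_supersolution p q u.
Hypothesis u_ge0 : forall t x, 0 <= t -> 0 <= u (t, x).

Lemma positive_neighborhood t0 y : 0 < t0 -> 0 < u (t0, y) ->
  exists e d : R, [/\ 0 < e, 0 < d, d < t0 &
    forall t x, t0 - d <= t <= t0 -> enorm (x - y) <= d -> e <= u (t, x)].
Proof.
move=> t00 uy; have e0 : 0 < u (t0, y) / 2 by rewrite divr_gt0.
have /(_ (t0, y) (ltW t00)) h := (subspace_continuousP _ _).1 cu.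
have /cvgrPdist_lt/(_ _ e0) := h; rewrite near_withinE => /nbhs_ballP[d /= d0 hd].
pose d' := Num.min (d / 2) (t0 / 2).
have d'0 : 0 < d' by rewrite lt_min !divr_gt0.
have d'd : d' < d by rewrite gt_min; apply/orP; left; lra.
have d't : d' < t0 by rewrite gt_min; apply/orP; right; lra.
exists (u (t0, y) / 2), d'; split => // t x /andP[t1 t2] xd.
have : `|u (t0, y) - u (t, x)| < u (t0, y) / 2.
  apply: hd; last by rewrite /=; lra.
  split; first by rewrite /ball/= ger0_norm; lra.
  have : ball_ Num.norm y d x.
    by rewrite /= distrC (le_lt_trans (ler_norm_enorm _))// (le_lt_trans xd).
  by rewrite ball_normE.
by rewrite ltr_norml => /andP[_]; lra.
Qed.

(** The solution is at least [e] on a ball around [y] of radius [d] during a time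
[d] before [t0].  Outside this ball it is compared with a bump whose positivity
set grows from that ball to the ball of radius [rho] between [t0 - d] and [t0].
A steep bump satisfies Delta_p >= 2 |grad|^(p-1), of which one half compensates the
absorption, since |grad| <= 1 and q >= p - 1, and the other, of order k^(p-1), the
time derivative [k * b]. *)
Lemma instantaneous_spreading t0 y : 0 < t0 -> 0 < u (t0, y) ->
  forall x, 0 < u (t0, x).
Proof.
move=> t00 uy x; have [p1' p2'] := (p1, p2).
have m0 : 0 < m%:R :> R by rewrite ltr0n (ltn_trans _ m1).
have [e [d [e0 d0 dt0 hd]]] := positive_neighborhood t00 uy.
have [xd|xd] := leP (enorm (x - y)) d.
  by apply: (lt_le_trans e0); apply: hd => //; rewrite lexx andbT; lra.
have [rho [rho0 xrho]] : exists rho : R, 0 < rho /\ enorm (x - y) < rho.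
  by exists (enorm (x - y) + 1); lra.
have drho : d < rho by exact: lt_trans xrho.
have mpos : (0 < 2 * m)%N by rewrite muln_gt0/= (ltn_trans _ m1).
pose k0 : R := N%:R + p - 2 + 2 * (p - 1) * (m%:R - 1).
have m1' : 1 <= m%:R :> R by rewrite ler1n (ltn_trans _ m1).
have pm0 : 0 < 2 * (p - 1) * m%:R by rewrite !mulr_gt0//; lra.
have dm0 : 0 < d ^+ (2 * m) by exact: exprn_gt0.
(* This steepness makes the last factor in [p_laplacian_exp] at least [2 * rho]. *)
have [A A0 AE] : exists2 A : R, 0 < A &
    2 * (p - 1) * m%:R * (A * d ^+ (2 * m)) = `|k0| + 2 * rho.
  exists ((`|k0| + 2 * rho) / (2 * (p - 1) * m%:R * d ^+ (2 * m))).
    by apply: divr_gt0; [rewrite ltr_wpDl// mulr_gt0|exact: mulr_gt0].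
  by field; rewrite !gt_eqF//; lra.
pose h r := expR (- (A * r ^+ (2 * m))).
have h0 r : 0 < h r by exact: expR_gt0.
have hdec r s : 0 <= r -> r < s -> h s < h r.
  move=> r0 rs; rewrite ltr_expR ltrN2 ltr_pM2l//.
  by rewrite ltr_pXn2r// nnegrE// ltW// (le_lt_trans r0).
have h1 r : 0 <= r -> h r <= 1.
  by move=> r0; rewrite -[leRHS]expR0 ler_expR oppr_le0 mulr_ge0 ?(ltW A0)// exprn_ge0.
pose b := (h d - h rho) / d.
have b0 : 0 < b by rewrite divr_gt0// subr_gt0 hdec// ltW.
pose n := (2 * m.-1).+1.
(* [k * c2] and [k * c3] bound the gradient from below and from above. *)
have [c2 c20 c2E] : exists2 c2 : R, 0 < c2 & c2 = 2 * m%:R * A * d ^+ n * h rho.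
  exists (2 * m%:R * A * d ^+ n * h rho) => //.
  by rewrite mulr_gt0// mulr_gt0 ?exprn_gt0// mulr_gt0// mulr_gt0.
have [c3 c30 c3E] : exists2 c3 : R, 0 < c3 & c3 = 2 * m%:R * A * rho ^+ n.
  exists (2 * m%:R * A * rho ^+ n) => //.
  by rewrite mulr_gt0 ?exprn_gt0// mulr_gt0// mulr_gt0.
have [k [k_gt0 ke kc3 kb]] : exists k : R, [/\ 0 < k, k <= e, k * c3 <= 1 &
    k * b <= k `^ (p - 1) * c2 `^ (p - 1)].
  pose z := (c2 `^ (p - 1) / b) `^ ((2 - p)^-1).
  have z0 : 0 < z by rewrite powR_gt0// divr_gt0// powR_gt0.
  exists (Num.min e (Num.min c3^-1 z)).
  have [kz ke kc3] : [/\ Num.min e (Num.min c3^-1 z) <= z,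
     Num.min e (Num.min c3^-1 z) <= e & Num.min e (Num.min c3^-1 z) <= c3^-1].
    by rewrite !ge_min !lexx !orbT.
  have k0' : 0 < Num.min e (Num.min c3^-1 z) by rewrite !lt_min e0 invr_gt0 c30.
  move: (Num.min _ _) kz ke kc3 k0' => k kz ke kc3 k0'; split => //.
    by rewrite -ler_pdivlMr// div1r.
  have kE : k = k `^ (p - 1) * k `^ (2 - p).
    rewrite -powRD; last by rewrite (gt_eqF k0') implybT.
    by rewrite (_ : p - 1 + (2 - p) = 1) ?powRr1 ?(ltW k0')//; ring.
  rewrite {1}kE.
  rewrite -mulrA ler_pM2l ?powR_gt0// -ler_pdivlMr//.
  apply: (@le_trans _ _ (z `^ (2 - p))).
    by apply: ge0_ler_powR; rewrite ?nnegrE ?(ltW k0') ?(ltW z0)//; lra.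
  have p2n : 2 - p != 0 by rewrite gt_eqF// subr_gt0.
  by rewrite /z -powRrM (mulVf p2n) powRr1// ltW// divr_gt0// powR_gt0.
pose F := exp_profile (- (k * h d)) k A.
have hF := C2_profile_exp (- (k * h d)) k A.
have F1n0 s : 0 <= s -> - (k * A) * expR (- (A * s)) != 0.
  by move=> _; apply: exp_profile_slope_neq0; rewrite gt_eqF.
pose Do := [set z : 'rV[R]_N | d ^+ 2 < sqdist y z < rho ^+ 2].
pose D := [set z : 'rV[R]_N | d ^+ 2 <= sqdist y z <= rho ^+ 2].
have FE z : radial m y F z = k * (h (enorm (z - y)) - h d).
  by rewrite /radial /F /exp_profile sqdistE -exprM /h; ring.
have Dr z : D z -> d <= enorm (z - y) <= rho.
  by rewrite /D /= sqdistE !ler_pXn2r// nnegrE ?enorm_ge0// ltW.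
have xD : D x by rewrite /D /= sqdistE !ler_pXn2r ?nnegrE ?enorm_ge0 ?(ltW d0) ?(ltW rho0)// (ltW xd) (ltW xrho).
have t1E : t0 - (t0 - d) = d by ring.
have main : radial m y F x + k * b * (t0 - (t0 - d)) <= u (t0, x).
  apply: (@supersolution_comparison _ _ p q u m y m1 mp cu F _ _ hF F1n0 D Do (t0 - d) t0 _ _ _ _ _ sup).
  - exact: compact_annulus.
  - exact: open_annulus.
  - by move=> z /= /andP[h2 h3]; apply/andP; split; exact: ltW.
  - by rewrite subr_ge0 ltW.
  - move=> z Dz; have : D z by move: Dz => /= /andP[h2 h3]; apply/andP; split; exact: ltW.
    move=> /Dr; set r := enorm (z - y) => /andP[r1 r2].
    have r0 : 0 < r by exact: lt_le_trans r1.
    have zy : z != y by rewrite -subr_eq0 -enorm_gt0.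
    split => //; have k_neq0 : k != 0 by rewrite gt_eqF.
    rewrite (p_laplacian_exp _ _ m1 zy k_neq0 A0) gtr0_sg// mul1r -/r -/k0.
    have := enorm_grad_exp (- (k * h d)) k m y z (ltW A0).
    rewrite (gtr0_norm k_gt0) -/n -/r -/(h r); set g := enorm (grad _ _) => gE.
    have coef : 0 < 2 * m%:R * k * A by rewrite mulr_gt0// mulr_gt0// mulr_gt0.
    have rn0 : 0 <= r ^+ n by exact: exprn_ge0 (ltW r0).
    have glo : k * c2 <= g.
      have -> : k * c2 = 2 * m%:R * k * A * d ^+ n * h rho by rewrite c2E; ring.
      have dn0 : 0 <= d ^+ n by exact: exprn_ge0 (ltW d0).
      rewrite gE; apply: ler_pM; [exact: mulr_ge0 (ltW coef) dn0|exact: ltW| |].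
        by rewrite ler_pM2l// ler_pXn2r// nnegrE ltW.
      have [->//|rn] := eqVneq r rho.
      by apply: ltW; apply: hdec; [exact: ltW|rewrite lt_neqAle rn r2].
    have ghi : g <= 1.
      apply: le_trans kc3; rewrite gE.
      have -> : k * c3 = 2 * m%:R * k * A * rho ^+ n * 1 by rewrite c3E; ring.
      apply: ler_pM; [exact: mulr_ge0 (ltW coef) rn0|exact: ltW| |exact: h1 (ltW r0)].
      by rewrite ler_pM2l// ler_pXn2r// nnegrE ltW.
    have g0 : 0 < g by apply: lt_le_trans glo; exact: mulr_gt0.
    have gq : g `^ q <= g `^ (p - 1) by apply: ger_powR => //; rewrite g0.
    have gp : k * b <= g `^ (p - 1).
      apply: (le_trans kb); rewrite -powRM ?(ltW k_gt0) ?(ltW c20)//.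
      apply: ge0_ler_powR; rewrite ?nnegrE ?(ltW g0)//; first by rewrite subr_ge0 ltW.
      by rewrite mulr_ge0// ltW.
    have W : 2 <= (2 * (p - 1) * m%:R * (A * r ^+ (2 * m)) - k0) / r.
      rewrite ler_pdivlMr//; apply: (@le_trans _ _ (2 * rho)); first by rewrite ler_pM2l.
      have : `|k0| + 2 * rho <= 2 * (p - 1) * m%:R * (A * r ^+ (2 * m)).
        by rewrite -AE ler_pM2l// ler_pM2l// ler_pXn2r// nnegrE ltW.
      by have := ler_norm k0; lra.
    have gp0 : 0 <= g `^ (p - 1) by exact: powR_ge0.
    rewrite lerBrDr -mulrAC -mulrA; apply: le_trans (ler_wpM2l gp0 W).
    by rewrite mulr_natr mulr2n; exact: lerD.
  - move=> z Dz; have /andP[r1 r2] := Dr _ Dz.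
    rewrite FE; apply: (@le_trans _ _ 0); last by apply: u_ge0; rewrite subr_ge0 ltW.
    rewrite pmulr_rle0// subr_le0.
    have [->//|rn] := eqVneq d (enorm (z - y)).
    by apply: ltW; apply: hdec; [exact: ltW|rewrite lt_neqAle rn r1].
  - move=> t z /andP[t1 t2] Dz nDo; have /andP[r1 r2] := Dr _ Dz.
    have tb : k * b * (t - (t0 - d)) <= k * (h d - h rho).
      rewrite -mulrA ler_pM2l// /b mulrAC ler_pdivrMr//.
      by rewrite ler_pM2l ?subr_gt0 ?hdec ?(ltW d0)//; lra.
    rewrite FE; have [rr|rr] := leP rho (enorm (z - y)).
      have -> : enorm (z - y) = rho by apply/eqP; rewrite eq_le rr r2.
      by have := u_ge0 z (_ : 0 <= t); lra.
    have rE : enorm (z - y) = d.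
      apply/eqP; rewrite eq_le r1 andbT leNgt; apply/negP => dr; apply: nDo.
      by rewrite /Do /= sqdistE !ltr_pXn2r ?nnegrE ?enorm_ge0 ?(ltW d0) ?(ltW rho0)// dr rr.
    rewrite rE subrr mulr0 add0r; apply: (le_trans tb).
    apply: (@le_trans _ _ e); last by apply: hd; [rewrite t1 t2|rewrite rE].
    apply: le_trans ke; rewrite ger_pMr//.
    by have := h1 _ (ltW d0); have := h0 rho; lra.
  - by rewrite lexx andbT; lra.
  - exact: xD.
apply: lt_le_trans main; rewrite FE t1E -mulrA /b divfK ?gt_eqF//.
rewrite -mulrDr mulr_gt0//.
by have := hdec _ _ (enorm_ge0 (x - y)) xrho; lra.
Qed.

End positivity.

(** * Conclusion *)

Lemma extinction_time_exists (R : realType) (N : nat) (u : R * 'rV[R]_N -> R) :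
  (forall t x, 0 <= t -> 0 <= u (t, x)) ->
  (forall t0 x, 0 <= t0 -> forall e : R, 0 < e ->
    exists2 d : R, 0 < d & forall t, 0 <= t -> `|t - t0| < d -> `|u (t, x) - u (t0, x)| < e) ->
  (forall t1, 0 <= t1 -> (forall x, u (t1, x) <= 0) -> forall t x, t1 <= t -> u (t, x) <= 0) ->
  (exists2 T : R, 0 <= T & forall x, u (T, x) = 0) ->
  exists Te : R, extinction_time u Te.
Proof.
move=> u_ge0 cont persist [T T0 uT].
pose Z := [set t : R | 0 <= t /\ forall x, u (t, x) = 0].
have ZT : Z T by [].
have lbZ : lbound Z 0 by move=> t [].
have hiZ : has_inf Z by split; [exists T|exists 0].
have Te0 : 0 <= inf Z by apply: lb_le_inf => //; exists T.
have after t x : inf Z < t -> u (t, x) = 0.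
  move=> Zt; have [s [s0 us] st] := inf_lt (ex_intro _ T ZT) Zt.
  apply/eqP; rewrite eq_le u_ge0 ?andbT; last by rewrite (le_trans s0)// ltW.
  by apply: (persist s) => //; [move=> y; rewrite us|exact: ltW].
exists (inf Z); split => //.
  move=> t x; rewrite le_eqVlt => /orP[/eqP <-|/after//].
  apply/eqP; rewrite eq_le u_ge0// andbT leNgt; apply/negP => uZ.
  have [d d0 hd] := cont _ x Te0 _ uZ.
  have := hd (inf Z + d / 2) _ _; rewrite after ?ltrDl ?divr_gt0//.
  rewrite sub0r normrN (gtr0_norm uZ) ltxx => h.
  suff : false by []; apply: h; first by rewrite addr_ge0// divr_ge0// ltW.
  by rewrite addrC addKr gtr0_norm; lra.
move=> t /andP[t0 tZ]; apply/not_existsP => h.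
have : Z t by split => // x; apply/eqP; apply: contrapT => /negP; exact: h.
by move=> Zt; have := ge_inf (ex_intro _ 0 lbZ) Zt; rewrite leNgt tZ.
Qed.

Theorem proposition4p4 (R : realType) (N : nat) (p q : R)
    (u0 : 'rV[R]_N -> R) (C0 Q : R) (u : R * 'rV[R]_N -> R) :
  (1 <= N)%N ->
  p_crit N < p < 2 ->
  p - 1 <= q < p / 2 ->
  W1oo u0 ->
  (forall x, 0 <= u0 x) ->
  (exists x, u0 x != 0) ->
  0 < C0 -> 0 < Q ->
  (q_one N p < q < p / 2 -> Q = q) ->
  (0 < q <= q_one N p -> q_one N p < Q < p / 2) ->
  (forall x, x != 0 ->
    u0 x <= C0 * enorm x `^ (- ((p - Q) / (Q - p + 1)))) ->
  solution p q u0 u ->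
  exists Te : R, extinction_time u Te /\
    forall t, 0 < t < Te -> positivity_set u t = [set: 'rV[R]_N].
Proof.
case: N u0 u => // n u0 u _ /andP[pc p2] /andP[pq qp] _ _ _ C00 _ Qq Qq1 u0_decay.
case=> cu [M0 uM0] _ u_init sub sup _ u_ge0 _.
have p1 : 1 < p.
  apply: le_lt_trans pc; rewrite /p_crit ler_pdivlMr ?ltr_wpDl// mul1r.
  have : 1 <= n.+1%:R :> R by rewrite ler1n.
  by lra.
have [q1Q Qp qQ] : [/\ q_one n.+1 p < Q, Q < p / 2 & q <= Q].
  have [q1q|qq1] := ltP (q_one n.+1 p) q.
    by rewrite (Qq _) ?q1q.
  have /andP[h1 h2] : q_one n.+1 p < Q < p / 2 by apply: Qq1; rewrite qq1 andbT; lra.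
  by split => //; rewrite (le_trans qq1)// ltW.
have pQ : p - 1 < Q by apply: le_lt_trans q1Q; rewrite /q_one le_max lexx.
set gam := (p - Q) / (Q - p + 1) in u0_decay.
have w0 : 0 < Q - p + 1 by lra.
have gam0 : 0 < gam by rewrite divr_gt0//; lra.
have gamE : (gam + 1) * (Q - p + 1) = 1 by rewrite /gam; field; rewrite gt_eqF.
have pgam : p < gam * (2 - p).
  by rewrite /gam mulrAC ltr_pdivlMr//; lra.
have [m m1 mp] : exists2 m, (1 < m)%N & 1 < (2 * m%:R - 1) * (p - 1).
  have p10 : 0 < p - 1 by lra.
  exists (Num.bound (p - 1)^-1).+2 => //.
  have inv0 : 0 < (p - 1)^-1 by rewrite invr_gt0.
  have := archi_boundP (ltW inv0); set B : R := (Num.bound _)%:R => hB.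
  rewrite -[X in X < _](mulVf (lt0r_neq0 p10)) ltr_pM2r//.
  by rewrite -addn2 natrD -/B; lra.
have [M Mgt0 uM] : exists2 M : R, 0 < M & forall t x, 0 <= t -> u (t, x) <= M.
  exists (`|M0| + 1); first by rewrite ltr_wpDl.
  move=> t x t0; have := uM0 t x t0; have := ler_norm M0; have := ler_norm (u (t, x)).
  by lra.
have decay x : x != 0 -> u (0, x) <= C0 * enorm x `^ (- gam).
  by rewrite u_init; exact: u0_decay.
have [K [r0 [K0 r00 MK uK]]] := stationary_upper_bound (ltn0Sn n) p1 p2 m1 mp cu
  sub Mgt0 uM qQ pQ gam0 gamE C00 decay.
have ext := finite_time_extinction p1 p2 m1 mp cu sub u_ge0 K0 r00 pgam MK uM uK.
have persist := zero_persists p1 p2 m1 mp cu sub Mgt0 uM.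
have [Te hTe] := extinction_time_exists u_ge0 (time_continuity cu) persist ext.
exists Te; split => // t /andP[t0 tTe]; have [_ _ /(_ t)] := hTe.
rewrite (ltW t0) tTe => /(_ isT)[y uy].
have {}uy : 0 < u (t, y) by rewrite lt_neqAle eq_sym uy u_ge0// ltW.
apply/seteqP; split => // x _.
exact: (instantaneous_spreading p1 p2 pq m1 mp cu sup u_ge0 t0 uy).
Qed.
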